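(* Let $m\ge1$ and $r,s\ge0$ be integers, and let $\lambda,\kappa$ be partitions with $(|\lambda|,|\kappa|)=(r-i,s-i)$ for some integer $0\le i\le\min\{r,s\}$. Let $\mu$ and $\nu$ be partitions with no parts divisible by $m$. (1) If $|\mu|=r-m$ and $|\nu|=s$, then $\chi^{(r,s)}_{[\lambda,\kappa]}(\mu\cup(m),\nu)=\chi^{(r-m,s)}_{[-\phi^{(m)}_1(\lambda),\kappa]}(\mu,\nu)$. (2) If $|\mu|=r$ and $|\nu|=s-m$, then $\chi^{(r,s)}_{[\lambda,\kappa]}(\mu,\nu\cup(m))=\chi^{(r,s-m)}_{[\lambda,-\phi^{(m)}_1(\kappa)]}(\mu,\nu)$. Here $\mu\cup(m)$ is $\mu$ with a part $m$ appended, and $\chi_{[\lambda,\kappa]}$ is extended bilinearly in $\lambda,\kappa\in F$.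
   Context: **Operators $\phi^{(m)}_k$.** A maya diagram is a sequence of integers $[x_1,x_2,\ldots]$ with $x_1>x_2>\cdots$ and $x_i=-i$ for all sufficiently large $i$. Maya diagrams correspond bijectively to partitions: $\lambda=(\lambda_1,\ldots,\lambda_l)$ (extended by zeros) corresponds to $[\lambda_1-1,\lambda_2-2,\ldots]$; the same symbol is used for both. $F$ is the $\mathbb{C}$-vector space with basis all maya diagrams (equivalently, all partitions). A charged maya diagram is a strictly decreasing integer sequence with $x_{i+1}=x_i-1$ for all large $i$, and $\tilde F$ is the $\mathbb{C}$-vector space with these as basis. Sequences satisfying the condition at large $i$ but not necessarily decreasing are regarded as elements of $F$ or $\tilde F$ by the rule that swapping two entries changes the sign (a sequence with a repeated entry is zero). For integers $m\ge1$ and $k$, $\phi^{(m)}_k:F\to F$ is the linear operator $$\phi^{(m)}_k([x_1,x_2,\ldots])=\Bigl(\sum_{a_0,\ldots,a_{m-1}}[a_{m-1},\ldots,a_0,x_1,x_2,\ldots]\Bigr)-m,$$ the sum being over all integer $m$-tuples with $a_i\equiv i\pmod m$ and $a_0+\cdots+a_{m-1}=(0+1+\cdots+(m-1))-km$ (finitely many nonzero terms), where ''$-m$'' is the linear operator $[y_1,y_2,\ldots]\mapsto[y_1-m,y_2-m,\ldots]$. **Walled Brauer algebra characters.** For an indeterminate $x$, the Brauer algebra $D_n(x)$ is the $\mathbb{C}(x)$-algebra with basis all perfect matchings (Brauer diagrams) of $2n$ dots arranged in two rows of $n$; the product of diagrams $a$ and $b$ is obtained by stacking $a$ on top of $b$,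 removing closed loops, forgetting the middle row, and multiplying by $x^{\#\text{removed loops}}$. A permutation $w\in S_n$ is identified with the diagram connecting the $i$-th bottom dot with the $w(i)$-th top dot. For $r,s\ge 0$, the walled Brauer algebra $D_{r,s}(x)$ is the subalgebra of $D_{r+s}(x)$ spanned by all diagrams in which the dots $1,\ldots,r$ on the top (resp. bottom) row are not connected with the dots $r+1,\ldots,r+s$ on the bottom (resp. top) row. A permutation in $D_{r,s}(x)$ is an element of $S_r\times S_s$, with a left side (columns $1,\ldots,r$) and a right side (columns $r+1,\ldots,r+s$). $D_{r,s}(x)$ is semisimple and its irreducible representations are indexed in the standard way by pairs of partitions $[\lambda,\kappa]$ with $(|\lambda|,|\kappa|)=(r-i,s-i)$, $0\le i\le\min\{r,s\}$ (this bracket is not maya-diagram notation). $\chi^{(r,s)}_{[\lambda,\kappa]}$ is the corresponding irreducible character, and $\chi^{(r,s)}_{[\lambda,\kappa]}(\mu,\nu)$ is its value at a permutation whose left and right sides have cycle types $\mu$ and $\nu$. The labelling is the one for which the following known Frobenius-type formula holds (Halverson): $\chi^{(r,s)}_{[\lambda,\kappa]}(\mu,\nu)$ is the coefficient of $1\otimes1$ in $A^+_{\mu_1}\cdots A^+_{\mu_l}A^-_{\nu_1}\cdots A^-_{\nu_{l'}}(s_\lambda\otimes s_\kappa)$ in $\Lambda\otimes\Lambda$ ($\Lambda$ the ring of symmetric functions), where $A^+_i=p_i^\perp(X)+p_i(Y)$, $A^-_i=p_i(X)+p_i^\perp(Y)$; here $G(X)$, $G(Y)$ denote an operator $G$ on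 $\Lambda$ acting on the first, resp. second, tensor factor, $p_i$ is multiplication by the $i$-th power sum, and $p_i^\perp$ is its adjoint for the Hall inner product ($\langle s_\lambda,s_\mu\rangle=\delta_{\lambda\mu}$).
   Formalization: The walled Brauer algebra is taken in its standard form, where horizontal edges must also join the left side to the right side; the description forbidding only vertical edges across the wall does not give a subalgebra (e.g. r=2, s=1) and contradicts the indexing by pairs of partitions. *)

(* Defs.v *)
From HB Require Import structures.
From mathcomp Require Import all_boot all_order all_algebra all_fingroup finmap.
From mathcomp Require Import boolp classical_sets fsbigop reals.
From mathcomp Require Import complex.
From mathcomp Require mpoly.
From mathcomp Require Import monalg.

Set Implicit Arguments.
Unset Strict Implicit.
Unset Printing Implicit Defensive.

Import Order.TTheory GRing.Theory Num.Theory.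

Local Open Scope ring_scope.
Local Open Scope classical_set_scope.

Definition lin_ext (G : nzRingType) (T : choiceType) (V : lmodType G)
    (f : T -> V) (u : {malg G[T]}) : V :=
  \sum_(k <- msupp u) u@_k *: f k.

Definition is_part (s : seq nat) : bool := sorted geq s && (0%N \notin s).

Record intpart := IntPart { parts :> seq nat; _ : is_part parts }.

HB.instance Definition _ := [isSub for parts].
HB.instance Definition _ := [Choice of intpart by <:].

Lemma is_part_sort (s : seq nat) :
  is_part (sort geq [seq x <- s | x != 0%N]).
Proof.
apply/andP; split; first by apply: sort_sorted => x y; exact: leq_total.
by rewrite mem_sort mem_filter eqxx.
Qed.

(* the partition with the nonzero entries of s as parts *)
Definition part_of_seq (s : seq nat) : intpart := IntPart (is_part_sort s).

Definition part0 : intpart := part_of_seq [::].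

Definition psize (la : intpart) : nat := sumn la.

Definition part_add (m : nat) (mu : intpart) : intpart := part_of_seq (m :: mu).

Definition no_part_divisible (m : nat) (mu : intpart) : Prop :=
  forall j, j \in parts mu -> ~~ (m %| j)%N.

Definition cycle_type (n : nat) (w : 'S_n) : intpart :=
  part_of_seq [seq #|pred_of_set A| | A in porbits w].

(* F is the free module {malg G[intpart]} on the partitions.  A maya diagram (and
   more generally a sequence with x_i = -i for large i) is given by a finite
   prefix z: the seq int z stands for the sequence
   z_1, ..., z_l, -(l+1), -(l+2), ...  where l = size z. *)

Definition maya (la : intpart) : seq int :=
  mkseq (fun i => (nth 0%N la i)%:Z - i.+1%:Z) (size la).

Definition inversions (z : seq int) : nat :=
  (\sum_(j < size z) \sum_(i < j) (z`_i < z`_j)%R)%N.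

(* The element of F represented by a not necessarily decreasing sequence.  An
   entry of z smaller than - size z also occurs in the tail, and gives 0. *)
Definition straighten (G : nzRingType) (z : seq int) : {malg G[intpart]} :=
  let d := sort (fun a b : int => b <= a) z in
  if uniq z && all (fun a => - (size z)%:Z <= a) z then
    << (-1) ^+ inversions z *g
       part_of_seq (mkseq (fun i => absz (d`_i + i.+1%:Z)) (size z)) >>
  else 0.

Definition phi_tuples (m : nat) (k : int) : set (m.-tuple int) :=
  [set a | (forall i : 'I_m, (tnth a i = i%:Z %[mod m%:Z])%Z) /\
           \sum_(i < m) tnth a i = (\sum_(i < m) i%:Z) - k * m%:Z].
Arguments phi_tuples : clear implicits.

(* Subtracting m from every entry of the sequence a_(m-1), ..., a_0, x_1, ...
   turns its tail back into that of an element of F, which is why it is done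
   before straightening (the order of the two operations is immaterial). *)
Definition phi_maya (G : nzRingType) (m : nat) (k : int) (la : intpart) :
    {malg G[intpart]} :=
  \sum_(a \in phi_tuples m k)
    straighten G [seq y - m%:Z | y <- rev a ++ maya la].

Definition phi (G : nzRingType) (m : nat) (k : int) :
    {malg G[intpart]} -> {malg G[intpart]} :=
  lin_ext (phi_maya G m k).

(* The ring of symmetric functions, as a group: it is free on the Schur
   functions, << la >> being s_la.  An element is determined by its
   specializations to finitely many variables, given by [sym_eval]. *)
Definition Lambda := {malg int[intpart]}.

(* the field Q(x_1, ..., x_N) as the fraction field of Z[x_1, ..., x_N] *)
Module SymField.
(* local, and without its notations, which clash with those of monalg *)
Import mpoly.

Definition sfield (N : nat) := {fraction (mpoly N int)}.

Definition svar (N : nat) (i : 'I_N) : sfield N :=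
  FracField.tofrac (mpolyX int (mnm1 i)).

End SymField.
Export SymField.

Definition alternant (N : nat) (e : 'I_N -> nat) : sfield N :=
  \det (\matrix_(i < N, j < N) svar j ^+ e i).

Definition schur_poly (N : nat) (la : intpart) : sfield N :=
  if (size la <= N)%N then
    alternant (fun i : 'I_N => nth 0 la i + (N - i.+1))%N
      / alternant (fun i : 'I_N => N - i.+1)%N
  else 0.

Definition sym_eval (N : nat) (f : Lambda) : sfield N :=
  \sum_(la <- msupp f) (f@_la)%:~R * schur_poly N la.

Definition hall (f g : Lambda) : int := \sum_(la <- msupp f) f@_la * g@_la.

(* multiplication by the i-th power sum *)
Definition psum_mul (i : nat) (f : Lambda) : Lambda :=
  xget 0 [set g : Lambda | forall N,
    sym_eval N g = (\sum_(j < N) svar j ^+ i) * sym_eval N f].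

(* its adjoint for the Hall inner product *)
Definition psum_perp (i : nat) (f : Lambda) : Lambda :=
  xget 0 [set g : Lambda | forall h, hall g h = hall f (psum_mul i h)].

(* Lambda (x) Lambda, with basis s_la (x) s_ka = << (la, ka) >> *)
Definition Lambda2 := {malg int[(intpart * intpart)%type]}.

Definition tens (f g : Lambda) : Lambda2 :=
  \sum_(la <- msupp f) \sum_(ka <- msupp g) << f@_la * g@_ka *g (la, ka) >>.

Definition onX (T : Lambda -> Lambda) : Lambda2 -> Lambda2 :=
  lin_ext (G := int) (fun p : intpart * intpart => tens (T << p.1 >>) << p.2 >>).

Definition onY (T : Lambda -> Lambda) : Lambda2 -> Lambda2 :=
  lin_ext (G := int) (fun p : intpart * intpart => tens << p.1 >> (T << p.2 >>)).

Definition Aplus (i : nat) (t : Lambda2) : Lambda2 :=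
  onX (psum_perp i) t + onY (psum_mul i) t.

Definition Aminus (i : nat) (t : Lambda2) : Lambda2 :=
  onX (psum_mul i) t + onY (psum_perp i) t.

(* coefficient of 1 (x) 1 in
   A^+_(mu_1) ... A^+_(mu_l) A^-_(nu_1) ... A^-_(nu_l') (s_la (x) s_ka) *)
Definition frobenius_coeff (la ka mu nu : intpart) : int :=
  (foldr Aplus (foldr Aminus << (la, ka) >> nu) mu)@_(part0, part0).

(* (true, i) is the i-th top dot, (false, i) the i-th bottom dot *)
Definition dot (n : nat) := (bool * 'I_n)%type.

(* A perfect matching is given by the fixed-point free involution that sends
   each dot to its partner. *)
Definition is_matching (n : nat) (f : {ffun dot n -> dot n}) : bool :=
  [forall d, (f d != d) && (f (f d) == d)].

Record diagram (n : nat) :=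
  Diagram { partner :> {ffun dot n -> dot n}; _ : is_matching partner }.

HB.instance Definition _ n := [isSub for @partner n].
HB.instance Definition _ n := [Finite of diagram n by <:].

(* Stacking a on top of b: the rows 0, 1 (middle), 2 of dots, with the edges of
   a between the rows 0, 1 and those of b between the rows 1, 2. *)
Definition stack_dot (n : nat) := ('I_3 * 'I_n)%type.

Definition row_above (n : nat) (d : dot n) : stack_dot n :=
  (if d.1 then inord 0 else inord 1, d.2).

Definition row_below (n : nat) (d : dot n) : stack_dot n :=
  (if d.1 then inord 1 else inord 2, d.2).

Definition row_outer (n : nat) (d : dot n) : stack_dot n :=
  (if d.1 then inord 0 else inord 2, d.2).

Definition stack_edge (n : nat) (a b : diagram n) : rel (stack_dot n) :=
  fun u v =>
    [exists d, (u == row_above d) && (v == row_above (a d))] ||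
    [exists d, (u == row_below d) && (v == row_below (b d))].

(* c is the diagram obtained by forgetting the closed loops and the middle
   row; there is exactly one such c for each a and b. *)
Definition is_stack (n : nat) (a b c : diagram n) : bool :=
  [forall d, connect (stack_edge a b) (row_outer d) (row_outer (c d))].

Definition component (n : nat) (a b : diagram n) (u : stack_dot n) :
    {set stack_dot n} := [set v in connect (stack_edge a b) u].

Definition loops (n : nat) (a b : diagram n) : nat :=
  #|[set A in [set component a b u | u : stack_dot n]
        | A \subset [pred v | val v.1 == 1%N]]|.

Definition perm_ffun (n : nat) (w : 'S_n) : {ffun dot n -> dot n} :=
  [ffun d : dot n => if d.1 then (false, (w^-1)%g d.2) else (true, w d.2)].

Lemma perm_ffun_matching (n : nat) (w : 'S_n) : is_matching (perm_ffun w).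
Proof.
by apply/forallP => -[[] i]; rewrite !ffunE /= ?permK ?permKV eqxx.
Qed.

Definition perm_diagram (n : nat) (w : 'S_n) : diagram n :=
  Diagram (perm_ffun_matching w).

(* Vertical edges do not cross the wall between the columns r and r+1, and
   horizontal edges do.  (Forbidding only the vertical edges that cross the wall
   would not give a subalgebra.) *)
Definition walled (r s : nat) (a : diagram (r + s)) : bool :=
  [forall d, ((a d).1 != d.1) == (((a d).2 < r)%N == (d.2 < r)%N)].

Record wdiagram (r s : nat) :=
  WDiagram { wdiag :> diagram (r + s); _ : walled wdiag }.

HB.instance Definition _ r s := [isSub for @wdiag r s].
HB.instance Definition _ r s := [Finite of wdiagram r s by <:].

Definition sides (r s : nat) (u : 'S_r) (v : 'S_s) (i : 'I_(r + s)) :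
    'I_(r + s) :=
  match split i with
  | inl j => lshift s (u j)
  | inr j => rshift r (v j)
  end.

Lemma sides_inj (r s : nat) (u : 'S_r) (v : 'S_s) : injective (sides u v).
Proof.
apply: (can_inj (g := sides u^-1 v^-1)) => i; rewrite /sides.
case: (splitP i) => j Hj.
  rewrite -[lshift s (u j)]/(unsplit (inl (u j))) unsplitK permK.
  by apply: val_inj; rewrite /= Hj.
rewrite -[rshift r (v j)]/(unsplit (inr (v j))) unsplitK permK.
by apply: val_inj; rewrite /= Hj.
Qed.

(* the element of S_r x S_s with left side u and right side v *)
Definition sides_perm (r s : nat) (u : 'S_r) (v : 'S_s) : 'S_(r + s) :=
  perm (@sides_inj r s u v).

Lemma sides_left (r s : nat) (u : 'S_r) (v : 'S_s) (i : 'I_(r + s)) :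
  (sides_perm u v i < r)%N = (i < r)%N.
Proof.
rewrite permE /sides; case: (splitP i) => j _ /=; first by rewrite ltn_ord.
by rewrite ltnNge leq_addr.
Qed.

Lemma sides_walled (r s : nat) (u : 'S_r) (v : 'S_s) :
  walled (perm_diagram (sides_perm u v)).
Proof.
apply/forallP => -[[] i]; rewrite ffunE /= ?sides_left ?eqxx //.
by rewrite -[in X in _ == (_ == X)](permKV (sides_perm u v) i) sides_left eqxx.
Qed.

Definition wperm (r s : nat) (u : 'S_r) (v : 'S_s) : wdiagram r s :=
  WDiagram (sides_walled u v).

(* C(x), where C = R[i] *)
Definition Cx (R : realType) := {fraction {poly R[i]}}.

Definition Cx_const (R : realType) (c : R[i]) : Cx R := FracField.tofrac c%:P.

Definition Cx_x (R : realType) : Cx R := FracField.tofrac 'X.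

Definition wbrauer (R : realType) (r s : nat) := {malg (Cx R)[wdiagram r s]}.

Definition wbrauer1 (R : realType) (r s : nat) : wbrauer R r s :=
  << wperm 1 1 >>.

Definition wbrauer_mul (R : realType) (r s : nat) (f g : wbrauer R r s) :
    wbrauer R r s :=
  \sum_(a <- msupp f) \sum_(b <- msupp g)
    \sum_(c : wdiagram r s | is_stack a b c)
      << f@_a * g@_b * Cx_x R ^+ loops a b *g c >>.

Definition is_repr (R : realType) (r s n : nat)
    (rho : {linear wbrauer R r s -> 'M[Cx R]_n}) : Prop :=
  rho (wbrauer1 R r s) = 1%:M /\
  forall f g, rho (wbrauer_mul f g) = rho f *m rho g.

Definition is_irr_repr (R : realType) (r s n : nat)
    (rho : {linear wbrauer R r s -> 'M[Cx R]_n}) : Prop :=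
  [/\ is_repr rho, (0 < n)%N &
      forall U : 'M[Cx R]_n, (forall f, stablemx U (rho f)) ->
        U = 0 \/ row_full U].

Definition is_irr_char (R : realType) (r s : nat)
    (X : wbrauer R r s -> Cx R) : Prop :=
  exists n (rho : {linear wbrauer R r s -> 'M[Cx R]_n}),
    is_irr_repr rho /\ forall f, X f = \tr (rho f).

Definition is_label (r s : nat) (la ka : intpart) : Prop :=
  exists i, [/\ (i <= minn r s)%N, psize la = (r - i)%N & psize ka = (s - i)%N].

(* A family chi r s la ka, meaningful when (la, ka) is a label for (r, s) *)
Definition char_family (R : realType) :=
  forall r s : nat, intpart -> intpart -> wbrauer R r s -> Cx R.

(* chi indexes the irreducible characters by the labels bijectively, and the
   labelling is the one for which Halverson's formula holds. *)
Record irr_labelling (R : realType) (chi : char_family R) : Prop := {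
  labelling_irr : forall r s la ka, is_label r s la ka ->
    is_irr_char (chi r s la ka);
  labelling_inj : forall r s la ka la' ka',
    is_label r s la ka -> is_label r s la' ka' ->
    chi r s la ka =1 chi r s la' ka' -> la = la' /\ ka = ka';
  labelling_surj : forall r s (X : wbrauer R r s -> Cx R), is_irr_char X ->
    exists la ka, is_label r s la ka /\ X =1 chi r s la ka;
  labelling_frobenius : forall r s la ka (u : 'S_r) (v : 'S_s),
    is_label r s la ka ->
    chi r s la ka << wperm u v >> =
      (frobenius_coeff la ka (cycle_type u) (cycle_type v))%:~R }.

(* chi_[la, ka], extended bilinearly to la, ka in F *)
Definition chi_ext (R : realType) (chi : char_family R) (r s : nat)
    (f g : {malg R[i][intpart]}) (h : wbrauer R r s) : Cx R :=
  \sum_(la <- msupp f) \sum_(ka <- msupp g)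
    Cx_const (f@_la) * Cx_const (g@_ka) * chi r s la ka h.

(* Main.v *)
From HB Require Import structures.
Require Import Defs.
From mathcomp Require Import all_boot all_order all_algebra all_fingroup finmap.
From mathcomp Require Import boolp classical_sets fsbigop.
From mathcomp Require Import reals complex monalg.
From mathcomp Require mpoly.
From mathcomp Require Import zify ring.

(** Both sides are given by the Frobenius-type formula, so the theorem is an
    identity between coefficients of 1 (x) 1 in Lambda (x) Lambda.  It rests on
    three facts about the operators p_j, their adjoints and
    phi = phi^(m)_1.

    - In the language of maya diagrams, p_j and its adjoint add j, respectively
      -j, to one entry of the sequence in all possible ways (Murnaghan-Nakayama).
      Both are instances of one operator [ribbon k], with k a nonzero integer,
      and [ribbon j] and [ribbon k] commute as soon as j + k is nonzero.  Hence
      A^+_i and A^-_i are the two signs of one operator [Aop], and the factor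
      for the new part m can be moved to the left of all the others.

    - phi commutes with p_j and its adjoint when m does not divide j
      ([phi_ribbon_comm]).  Changing one of the new entries a_i by j contributes
      nothing in total: it moves a_i to the residue class of another a_(i'), and
      swapping the two entries pairs the terms off with opposite signs.

    - On the coefficient of the empty partition, phi is the opposite of the
      adjoint of p_m ([phi_vacuum]).  For [a_(m-1), ..., a_0, x] to be, up to
      order, the sequence m-1, m-2, ..., every a_i must be i except for one which
      is i - m; exchanging this entry with the entry i of x, which becomes i - m,
      removes an m-ribbon from x at the cost of a sign.

    The leftmost factor p_m^perp(X) + p_m(Y) then contributes only through
    p_m^perp(X), because no product by p_m has a constant term.  Replacing
    p_m^perp(X) by -phi(X) and moving phi to the right, through factors whose
    indices are not divisible by m, gives part (1); part (2) is the same
    with X and Y exchanged.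

    All matrix coefficients are handled as determinants.  If a sequence x and a
    partition with maya sequence y agree beyond the place W, then the coefficient
    of the partition in the element represented by x is
    det (x_i == y_j) for i, j < W ([straight_coeff]).  Summing such determinants
    over the rows in which x is modified equals summing over the columns in which
    y is modified the other way ([sum_det_row_col]); this single identity yields
    the adjointness of [ribbon k] and [ribbon (- k)], the product of an alternant
    by a power sum, and the commutation of phi with ribbons. *)

Set Implicit Arguments.
Unset Strict Implicit.
Unset Printing Implicit Defensive.

Import Order.TTheory GRing.Theory Num.Theory.

Local Open Scope ring_scope.

(** * Determinants *)

(** Both sides are the derivative of det (M + t M') at t = 0, that is, the trace
    of adj M times M'. *)
Lemma sum_det_row_col (R : comNzRingType) n (M M' : 'M[R]_n) :
  \sum_a \det (\matrix_(i, j) if i == a then M' i j else M i j) =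
  \sum_b \det (\matrix_(i, j) if j == b then M' i j else M i j).
Proof.
have row a : \det (\matrix_(i, j) if i == a then M' i j else M i j)
    = \sum_b M' a b * cofactor M a b.
  rewrite (expand_det_row _ a); apply: eq_bigr => b _; rewrite mxE eqxx.
  congr (_ * (_ * \det _)); apply/matrixP => i j; rewrite !mxE.
  by rewrite eq_sym (negPf (neq_lift _ _)).
have col b : \det (\matrix_(i, j) if j == b then M' i j else M i j)
    = \sum_a M' a b * cofactor M a b.
  rewrite (expand_det_col _ b); apply: eq_bigr => a _; rewrite mxE eqxx.
  congr (_ * (_ * \det _)); apply/matrixP => i j; rewrite !mxE.
  by rewrite [lift b j == b]eq_sym (negPf (neq_lift _ _)).
rewrite (eq_bigr _ (fun a _ => row a)) [RHS](eq_bigr _ (fun b _ => col b)).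
exact: exchange_big.
Qed.

Lemma det_row0 (R : comNzRingType) n (A : 'M[R]_n) a :
  (forall j, A a j = 0) -> \det A = 0.
Proof.
by move=> A0; rewrite (expand_det_row _ a) big1 // => j _; rewrite A0 mul0r.
Qed.

Lemma det_row_perm (R : comNzRingType) n (M M' : 'M[R]_n) (s : 'S_n) :
  (forall i j, M' i j = M (s i) j) -> \det M' = (-1) ^+ s * \det M.
Proof.
move=> e; have -> : M' = row_perm s M by apply/matrixP => i j; rewrite mxE e.
by rewrite row_permE det_mulmx det_perm.
Qed.

(** * Sequences and the partitions they represent *)

(** Sequences are kept infinite; computations take place in windows of their
    first W entries, with W large enough for all the sequences involved. *)
Definition maya_seq (la : intpart) (i : nat) : int := (nth 0%N la i)%:Z - i.+1%:Z.

Definition shift_at (x : nat -> int) (b : nat) (k : int) (i : nat) : int :=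
  if i == b then x i + k else x i.

Definition vacuum_from (n : nat) (x : nat -> int) := forall i, (n <= i)%N -> x i = - i.+1%:Z.

(** The signed number of bijections between the entries of [x] and those of [y]
    below the place [W]: the pairing of the wedges of their entries. *)
Definition match_det W (x y : nat -> int) : int :=
  \det (\matrix_(i < W, j < W) (x i == y j)%:R).

Definition straight (G : nzRingType) W (x : nat -> int) : {malg G[intpart]} :=
  straighten G (mkseq x W).

Lemma nth_part_anti (la : intpart) i j :
  (i <= j)%N -> (nth 0 la j <= nth 0 la i)%N.
Proof.
move=> ij; have [jl|] := ltnP j (size la); last by move=> ?; rewrite nth_default.
have /andP[so _] := valP la.
have := sorted_leq_nth (rev_trans leq_trans) leqnn 0%N so.
by apply => //; rewrite inE //; apply: leq_ltn_trans jl.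
Qed.

Lemma nth_part_gt0 (la : intpart) i : (i < size la)%N -> (0 < nth 0 la i)%N.
Proof.
move=> il; rewrite lt0n; apply: contra (proj2 (andP (valP la))) => /eqP <-.
exact: mem_nth.
Qed.

Lemma maya_seq_lt la i j : (i < j)%N -> maya_seq la j < maya_seq la i.
Proof. by move=> ij; have := nth_part_anti la (ltnW ij); rewrite /maya_seq; lia. Qed.

Lemma maya_seq_inj la : injective (maya_seq la).
Proof.
move=> i j; case: (ltngtP i j) => // ij; have := maya_seq_lt la ij; first by lia.
by lia.
Qed.

Lemma maya_seq_ge la i : - i.+1%:Z <= maya_seq la i.
Proof. by rewrite /maya_seq; lia. Qed.

Lemma maya_seq_tail (la : intpart) : vacuum_from (size la) (maya_seq la).
Proof. by move=> i il; rewrite /maya_seq nth_default //; lia. Qed.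

Lemma intpart_inj (la mu : intpart) W :
  (size la <= W)%N -> (size mu <= W)%N ->
  (forall i, (i < W)%N -> maya_seq la i = maya_seq mu i) -> la = mu.
Proof.
move=> laW muW eq.
have eqn i : nth 0%N la i = nth 0%N mu i.
  have [iW|Wi] := ltnP i W; first by have := eq i iW; rewrite /maya_seq; lia.
  by rewrite !nth_default //; apply: leq_trans Wi.
have sz (a b : intpart) : (forall i, nth 0%N a i = nth 0%N b i) -> (size a <= size b)%N.
  move=> e; rewrite leqNgt; apply/negP => /nth_part_gt0.
  by rewrite e nth_default.
apply: val_inj; apply: (@eq_from_nth _ 0%N) => //.
by apply/eqP; rewrite eqn_leq !sz.
Qed.

Lemma match_detC W x y : match_det W x y = match_det W y x.
Proof.
rewrite /match_det -det_tr; congr (\det _); apply/matrixP => i j.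
by rewrite !mxE eq_sym.
Qed.

Lemma match_det_perm W x y : match_det W x y != 0 ->
  exists s : 'S_W, forall i : 'I_W, x i = y (s i).
Proof.
move=> nz; apply: contrapT => H; move/eqP: nz; apply.
rewrite /match_det /determinant big1 // => s _.
have /existsNP[i /eqP ne] : ~ (forall i : 'I_W, x i = y (s i)) by move=> e; apply: H; exists s.
by rewrite (bigD1 i) //= mxE (negPf ne) mul0r mulr0.
Qed.

Lemma match_det_sum W x y : match_det W x y != 0 -> \sum_(i < W) x i = \sum_(i < W) y i.
Proof.
move=> /match_det_perm[s e]; rewrite (eq_bigr _ (fun i _ => e i)).
by rewrite [RHS](reindex_inj (@perm_inj _ s)).
Qed.

Lemma match_det_row0 W x y a : (a < W)%N ->
  (forall j, (j < W)%N -> x a != y j) -> match_det W x y = 0.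
Proof.
move=> aW H; apply: (det_row0 (a := Ordinal aW)) => j.
by rewrite mxE /= (negPf (H _ _)).
Qed.

Lemma match_det_col0 W x y b : (b < W)%N ->
  (forall i, (i < W)%N -> x i != y b) -> match_det W x y = 0.
Proof.
move=> bW H; rewrite match_detC; apply: (match_det_row0 bW) => i iW.
by rewrite eq_sym H.
Qed.

Lemma match_det_alt W x y a b : (a < W)%N -> (b < W)%N -> a <> b -> x a = x b ->
  match_det W x y = 0.
Proof.
move=> aW bW ab xab; apply: (@determinant_alternate _ _ _ (Ordinal aW) (Ordinal bW)).
  by apply/eqP => -[].
by move=> j; rewrite !mxE /= xab.
Qed.

Lemma eq_match_det W x x' y y' : (forall i, (i < W)%N -> x i = x' i) ->
  (forall i, (i < W)%N -> y i = y' i) -> match_det W x y = match_det W x' y'.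
Proof.
by move=> ex ey; congr (\det _); apply/matrixP => i j; rewrite !mxE ex ?ey.
Qed.

(** Two strictly decreasing sequences that match must be equal. *)
Lemma match_det_maya_seq (la mu : intpart) W : (size la <= W)%N -> (size mu <= W)%N ->
  match_det W (maya_seq la) (maya_seq mu) = (la == mu)%:R.
Proof.
move=> laW muW; case: eqVneq => [<-|ne].
  rewrite -(det1 _ W); congr (\det _); apply/matrixP => i j.
  by rewrite !mxE (inj_eq (@maya_seq_inj la)).
apply: contra_neq_eq ne => /match_det_perm[s e].
have pe : perm_eq (mkseq (maya_seq la) W) (mkseq (maya_seq mu) W).
  apply: uniq_perm.
  - by rewrite /mkseq map_inj_uniq ?iota_uniq //; exact: maya_seq_inj.
  - by rewrite /mkseq map_inj_uniq ?iota_uniq //; exact: maya_seq_inj.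
  move=> v; apply/mapP/mapP; case=> i; rewrite mem_iota add0n /= => iW ->.
    by exists (s (Ordinal iW)); rewrite ?mem_iota /= ?add0n ?ltn_ord // -e.
  exists ((s^-1)%g (Ordinal iW)); rewrite ?mem_iota /= ?add0n ?ltn_ord //.
  by rewrite e permKV.
have so ka : sorted (fun a b : int => b < a) (mkseq (maya_seq ka) W).
  have tr : transitive (fun a b : int => b < a) by move=> a b c /= h1 h2; apply: lt_trans h2 h1.
  rewrite sorted_pairwise //.
  apply/(pairwiseP 0) => i j; rewrite !inE size_mkseq => iW jW ij.
  by rewrite !nth_mkseq //; apply: maya_seq_lt.
have eq : mkseq (maya_seq la) W = mkseq (maya_seq mu) W.
  apply: (irr_sorted_eq _ _ (so la) (so mu) (perm_mem pe)).
    by move=> a b c /= h1 h2; apply: lt_trans h2 h1.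
  by move=> a /=; rewrite ltxx.
apply: (intpart_inj laW muW) => i iW.
by have := congr1 (fun s => nth 0 s i) eq; rewrite !nth_mkseq.
Qed.

(** A window may be enlarged by an entry of the common tail: its row is a unit
    vector. *)
Lemma match_det_stabS W x y : x W = - W.+1%:Z -> y W = - W.+1%:Z ->
  (forall j, (j < W)%N -> y j != - W.+1%:Z) -> match_det W.+1 x y = match_det W x y.
Proof.
move=> xW yW yN; rewrite /match_det (expand_det_row _ ord_max) (bigD1 ord_max) //=.
rewrite mxE xW yW eqxx mul1r big1 ?addr0; last first => [j jN|].
  rewrite mxE xW eq_sym (negPf (yN j _)) ?mul0r //.
  by have := ltn_ord j; rewrite ltnS leq_eqVlt => /predU1P[e|//]; case/eqP: jN; apply: val_inj.
rewrite /cofactor /= addnn -signr_odd odd_double expr0 mul1r.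
congr (\det _); apply/matrixP => i j; rewrite !mxE /=.
by rewrite /bump !(leqNgt W) !ltn_ord !add0n.
Qed.

Lemma match_det_stab W W' x (mu : intpart) : (size mu <= W)%N -> (W <= W')%N -> vacuum_from W x ->
  match_det W' x (maya_seq mu) = match_det W x (maya_seq mu).
Proof.
move=> muW WW' tx; rewrite -(subnKC WW'); elim: (W' - W)%N => [|d IH]; first by rewrite addn0.
rewrite addnS match_det_stabS ?IH //; first by rewrite tx ?leq_addr.
  by rewrite maya_seq_tail // (leq_trans muW) ?leq_addr.
by move=> j jW; have := maya_seq_ge mu j; lia.
Qed.

(** A partition with more parts than [x] has modified entries cannot match [x]:
    its last part is missed by the tail of [x]. *)
Lemma match_det_small W W' x (mu : intpart) : (W < size mu)%N -> (W < W')%N -> vacuum_from W x ->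
  (size mu <= W')%N -> match_det W' x (maya_seq mu) = 0.
Proof.
move=> Wmu WW' tx muW.
apply: (@match_det_row0 _ _ _ (size mu).-1) => [|j jW]; first by lia.
rewrite tx; last by lia.
have [jl|lj] := ltnP j (size mu); last by (rewrite maya_seq_tail; lia).
by have := nth_part_gt0 jl; rewrite /maya_seq; lia.
Qed.
Lemma nth_filter_pos (q : seq nat) i : sorted geq q ->
  nth 0%N [seq a <- q | a != 0%N] i = nth 0%N q i.
Proof.
elim: q i => [|a q IH] i //= so.
have sq := path_sorted so.
case: eqVneq => [a0|_] /=; last by case: i => //= i; apply: IH.
have q0 : all (pred1 0%N) q.
  have := order_path_min (rev_trans leq_trans) so.
  by rewrite a0; apply: sub_all => b /=; rewrite leqn0.
rewrite IH //; case: i => [|i] /=; rewrite ?a0.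
  by case: (q) q0 => //= b p /andP[/eqP].
by rewrite (all_pred1P _ _ q0) !nth_nseq; do 2 case: ifP.
Qed.

Lemma nth_part_of_seq (q : seq nat) i : sorted geq q ->
  nth 0%N (part_of_seq q) i = nth 0%N q i.
Proof.
move=> so; rewrite /= (sorted_sort (rev_trans leq_trans)) ?nth_filter_pos //.
exact: (sorted_filter (rev_trans leq_trans)).
Qed.

Lemma size_part_of_seq (q : seq nat) : (size (part_of_seq q) <= size q)%N.
Proof. by rewrite /= size_sort size_filter count_size. Qed.

Lemma sgz_prod (I : Type) (r : seq I) (P : pred I) (F : I -> int) :
  sgz (\prod_(i <- r | P i) F i) = \prod_(i <- r | P i) sgz (F i).
Proof. exact: (big_morph _ (@sgzM _) (sgz1 _)). Qed.

Lemma prod_sign (I : Type) (r : seq I) (P b : pred I) :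
  \prod_(i <- r | P i) (if b i then -1 else 1 : int) =
  (-1) ^+ (\sum_(i <- r | P i) b i).
Proof.
rewrite -prodrXr; apply: eq_bigr => i _.
by case: (b i).
Qed.

(** Reading the parity of the number of inversions as the sign of a Vandermonde
    determinant makes it visibly multiplicative under permutation of the entries. *)
Lemma sign_inversions W (x : nat -> int) : uniq (mkseq x W) ->
  (-1) ^+ inversions (mkseq x W) =
  sgz (\det (Vandermonde W (\row_(i < W) (- x i)))).
Proof.
move=> un; rewrite det_Vandermonde sgz_prod /inversions size_mkseq.
rewrite -prodrXr.
rewrite [RHS](eq_bigr (fun i : 'I_W => \prod_(j < W | (i < j)%N) (if x i < x j then -1 else 1))).
  rewrite [RHS](exchange_big_dep xpredT) //=; apply: eq_bigr => j _.
  rewrite -prod_sign; 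
  rewrite (big_ord_widen W (fun i : nat =>
    if (mkseq x W)`_i < (mkseq x W)`_j then -1 else 1) (ltnW (ltn_ord j))).
  by apply: eq_bigr => i ij; rewrite !nth_mkseq // (ltn_trans ij).
move=> i _; rewrite sgz_prod; apply: eq_bigr => j ij; rewrite !mxE.
have ne : x i != x j.
  rewrite -(nth_mkseq 0 x (ltn_ord i)) -(nth_mkseq 0 x (ltn_ord j)).
  by rewrite nth_uniq ?size_mkseq //; lia.
by case: ltgtP ne => // h _; [rewrite ltr0_sgz|rewrite gtr0_sgz]; lia.
Qed.

(** In the nondegenerate case, straightening is sorting; [s] is the sorting
    permutation. *)
Lemma straighten_spec W (x : nat -> int) :
  (forall i, (i < W)%N -> - W%:Z <= x i) -> uniq (mkseq x W) ->
  exists (ka : intpart) (s : 'S_W), [/\ (size ka <= W)%N,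
    forall i : 'I_W, maya_seq ka i = x (s i) &
    forall G, straight G W x = << (-1) ^+ s *g ka >>].
Proof.
move=> lo un; set z := mkseq x W.
set d := sort (fun a b : int => b <= a) z.
have sd : size d = W by rewrite size_sort size_mkseq.
have /tuple_permP[s ds] : perm_eq d (mktuple (fun i : 'I_W => x i)).
  by rewrite perm_sort /z /mkseq -val_enum_ord -map_comp; exact: perm_refl.
have de (i : 'I_W) : d`_i = x (s i).
  by rewrite ds -tnth_nth !tnth_mktuple.
have dgt i j : (i < j)%N -> (j < W)%N -> d`_j < d`_i.
  move=> ij jW; rewrite lt_neqAle; apply/andP; split.
    by rewrite nth_uniq ?sd ?sort_uniq // ?(ltn_trans ij) //; lia.
  have so : sorted (fun a b : int => b <= a) d.
    by apply: sort_sorted => a b; exact: le_total.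
  apply: (sorted_ltn_nth _ 0 so) => //; rewrite ?inE ?sd //.
  - by move=> a b c h1 h2; apply: le_trans h2 h1.
  - exact: ltn_trans jW.
have dge i : (i < W)%N -> - i.+1%:Z <= d`_i.
  move=> iW; have : forall e, (i + e < W)%N -> d`_(i + e) <= d`_i - e%:Z.
    elim=> [|e IH] eW; first by rewrite addn0 subr0.
    have := dgt (i + e)%N (i + e.+1)%N ltac:(lia) ltac:(lia).
    by have := IH ltac:(lia); lia.
  move=> /(_ (W.-1 - i)%N ltac:(lia)).
  have -> : (i + (W.-1 - i) = W.-1)%N by lia.
  have W1 : (W.-1 < W)%N by lia.
  have := lo _ (ltn_ord (s (Ordinal W1))); rewrite -(de (Ordinal W1)) /=.
  have aux (a b : int) : - W%:Z <= b -> b <= a - (W.-1 - i)%N%:Z -> - i.+1%:Z <= a.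
    by lia.
  exact: aux.
pose q := mkseq (fun i => absz (d`_i + i.+1%:Z)) W.
have soq : sorted geq q.
  apply/(sortedP 0%N) => i; rewrite size_mkseq => iW.
  rewrite !nth_mkseq ?(ltnW iW) //=.
  have aux (a b : int) : - i.+2%:Z <= b -> - i.+1%:Z <= a -> b < a ->
      (absz (b + i.+2%:Z)%R <= absz (a + i.+1%:Z)%R)%N by lia.
  by apply: aux; [apply: dge|apply/dge/ltnW|apply: dgt].
exists (part_of_seq q), s; split.
- by apply: leq_trans (size_part_of_seq _) _; rewrite size_mkseq.
- move=> i; rewrite /maya_seq nth_part_of_seq // nth_mkseq // -de.
  have aux (a : int) : - i.+1%:Z <= a -> (absz (a + i.+1%:Z))%:Z - i.+1%:Z = a by lia.
  by apply: aux; apply: dge.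
move=> G; rewrite /straight /straighten un size_mkseq /=.
have -> : all (fun a => - W%:Z <= a) z.
  apply/allP => a /mapP; case=> i; rewrite mem_iota add0n => /= iW ->.
  exact: lo.
congr << _ *g _ >>.
have : (-1) ^+ inversions z = (-1) ^+ s :> int.
  rewrite sign_inversions //.
  have un' : uniq (mkseq (nth 0 d) W) by rewrite -sd mkseq_nth sort_uniq.
  have inv0 : inversions (mkseq (nth 0 d) W) = 0%N.
    rewrite /inversions size_mkseq big1 // => j _; rewrite big1 // => i _.
    rewrite !nth_mkseq ?(ltn_trans (ltn_ord i)) //.
    by have := dgt i j (ltn_ord i) (ltn_ord j); case: ltgtP.
  have := sign_inversions un'; rewrite inv0 expr0.
  have -> : Vandermonde W (\row_i - d`_i) =
            col_perm s (Vandermonde W (\row_i - x i)).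
    by apply/matrixP => i j; rewrite !mxE de.
  rewrite -det_tr tr_col_perm row_permE det_mulmx det_perm det_tr sgzM.
  have -> : sgz ((-1) ^+ s : int) = (-1) ^+ s by case: (odd_perm s).
  move=> /(congr1 ( *%R ((-1) ^+ s))).
  by rewrite mulr1 mulrA -signr_addb addbb mul1r.
by move=> /(congr1 (fun t : int => t%:~R : G)); rewrite !rmorph_sign.
Qed.

Lemma straight_eq0 G W (x : nat -> int) i : (i < W)%N -> x i < - W%:Z -> straight G W x = 0.
Proof.
move=> iW lt; rewrite /straight /straighten size_mkseq ifF //; apply/negbTE.
rewrite negb_and; apply/orP; right; apply/allPn; exists (x i).
  by apply: map_f; rewrite mem_iota.
by rewrite -ltNge.
Qed.

Lemma nuniq_mkseq W (x : nat -> int) : ~~ uniq (mkseq x W) ->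
  exists i j : 'I_W, i != j /\ x i = x j.
Proof.
move=> nu; apply: contrapT => H; case/negP: nu.
apply/(uniqP 0) => i j; rewrite !inE size_mkseq => iW jW.
rewrite !nth_mkseq // => e; apply: contrapT => ij; apply: H.
by exists (Ordinal iW), (Ordinal jW); split => //; apply/eqP => -[].
Qed.

Lemma straight_nuniq G W (x : nat -> int) : ~~ uniq (mkseq x W) -> straight G W x = 0.
Proof. by move=> nu; rewrite /straight /straighten (negPf nu). Qed.

(** The coefficients of a straightened sequence are determinants, which turns the
    sign rule for swapped entries into antisymmetry in the rows. *)
Lemma straight_coeff G W (x : nat -> int) mu : (straight G W x)@_mu =
  if (size (parts mu) <= W)%N then (match_det W x (maya_seq mu))%:~R else 0.
Proof.
have [lo|] := pselect (forall i, (i < W)%N -> - W%:Z <= x i); last first.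
  move=> /existsNP[i /not_implyP[iW /negP]]; rewrite -ltNge => lt.
  rewrite (straight_eq0 _ iW lt) mcoeff0; case: ifP => // muW.
  rewrite (match_det_row0 iW) // => j jW; have := maya_seq_ge mu j; lia.
have [un|nu] := boolP (uniq (mkseq x W)); last first.
  rewrite straight_nuniq // mcoeff0; case: ifP => // _.
  have [i [j [ij e]]] := nuniq_mkseq nu.
  rewrite (@match_det_alt _ _ _ i j) //.
  by move=> h; case/eqP: ij; apply: val_inj.
have [ka [s [kaW kax ->]]] := straighten_spec lo un.
rewrite mcoeffU; case: ifP => muW; last by case: eqVneq muW kaW => // -> ->.
have := match_det_maya_seq kaW muW.
have -> : match_det W (maya_seq ka) (maya_seq mu) = (-1) ^+ s * match_det W x (maya_seq mu).
  by apply: det_row_perm => i j; rewrite !mxE kax.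
move=> /(congr1 (fun t : int => (((-1) ^+ s * t)%:~R : G))).
rewrite mulrA -signr_addb addbb mul1r => ->.
by case: eqP => _ /=; rewrite ?mulr1 ?mulr0 ?mulr1n ?mulr0n // rmorph_sign.
Qed.

(** * Antisymmetric functions of sequences *)

Notation lsum := (mmap (intmul 1)).

(** The second condition follows from the first only where 2 is not a zero
    divisor, so it is part of the definition.  The relational form of the first
    one also says that [G] depends on the first [W] entries only. *)
Definition antisym (V : nzRingType) W (G : (nat -> int) -> V) :=
  (forall (x x' : nat -> int) (s : 'S_W), (forall i : 'I_W, x' i = x (s i)) ->
     G x' = (-1) ^+ s * G x) /\
  (forall (x : nat -> int) (i j : 'I_W), i != j -> x i = x j -> G x = 0).

Lemma antisym_int W (G : (nat -> int) -> int) :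
  (forall (x x' : nat -> int) (s : 'S_W), (forall i : 'I_W, x' i = x (s i)) ->
     G x' = (-1) ^+ s * G x) -> antisym W G.
Proof.
move=> Ga; split=> // x i j ij e.
have := Ga x x (tperm i j); rewrite odd_tperm ij expr1 mulN1r.
have h t : x (nat_of_ord t) = x (nat_of_ord (tperm i j t)) by case: tpermP => [->|->|].
by move=> /(_ h); lia.
Qed.

(** A linear form given on partitions by an antisymmetric function of their maya
    sequences takes the value of this function on every sequence.  The bound
    [n] is there because [g] is usually known to agree with [G] only on
    partitions that are short compared with the window [W]. *)
Lemma lsum_straight (V : nzRingType) n W (G : (nat -> int) -> V) (g : intpart -> V) x :
  antisym W G -> (n <= W)%N -> vacuum_from n x ->
  (forall ka, (size (parts ka) <= n)%N -> g ka = G (maya_seq ka)) ->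
  (forall i, (i < W)%N -> - W%:Z <= x i) ->
  lsum g (straight int W x) = G x.
Proof.
move=> [Ga G0] nW tx gG lo.
have [un|nu] := boolP (uniq (mkseq x W)); last first.
  rewrite straight_nuniq // mmap0.
  by have [i [j [ij e]]] := nuniq_mkseq nu; rewrite (G0 x i j).
have [ka [s [kaW kax e]]] := straighten_spec lo un.
have kan : (size (parts ka) <= n)%N.
  rewrite leqNgt; apply/negP => nka.
  have := straight_coeff int W x ka; rewrite e mcoeffUU kaW (@match_det_small n) //.
    by move/eqP; rewrite signr_eq0.
  exact: leq_trans kaW.
rewrite e mmapU gG // (Ga _ _ _ kax) /= rmorph_sign mulrA -signr_addb addbb.
exact: mul1r.
Qed.

(** * Ribbon operators *)

Section LinExt.
Variables (G : nzRingType) (K : choiceType) (V : lmodType G) (f : K -> V).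
Local Open Scope fset_scope.

Lemma lin_extEw (d : {fset K}) u : msupp u `<=` d ->
  lin_ext f u = \sum_(k <- d) u@_k *: f k.
Proof.
move=> le; rewrite /lin_ext [LHS](big_fset_incl _ le) => //= x xd /mcoeff_outdom ->.
by rewrite scale0r.
Qed.

Lemma lin_ext_is_linear : linear (lin_ext f).
Proof.
move=> c u v; pose E := msupp u `|` msupp v `|` msupp (c *: u + v).
have [uE vE wE] : [/\ msupp u `<=` E, msupp v `<=` E & msupp (c *: u + v) `<=` E].
  by split; apply/fsubsetP => k; rewrite !inE => ->; rewrite ?orbT.
rewrite (lin_extEw uE) (lin_extEw vE) (lin_extEw wE).
rewrite scaler_sumr -big_split; apply/eq_bigr=> k _ /=.
by rewrite mcoeffD mcoeffZ scalerDl scalerA.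
Qed.

HB.instance Definition _ := GRing.isLinear.Build G {malg G[K]} V *:%R (lin_ext f)
  lin_ext_is_linear.

Lemma lin_extU k : lin_ext f << k >> = f k.
Proof. by rewrite (lin_extEw msuppU_le) big_seq_fset1 mcoeffUU scale1r. Qed.
End LinExt.

Lemma mcoeff_lin_ext (K : choiceType) (f : K -> {malg int[K]}) u k :
  (lin_ext f u)@_k = lsum (fun h => (f h)@_k) u.
Proof.
rewrite /lin_ext raddf_sum mmapE /=; apply: eq_bigr => h _.
by rewrite mcoeffZ intz.
Qed.

Lemma sum_widen n W (F : nat -> int) : (n <= W)%N ->
  (forall b, (n <= b)%N -> (b < W)%N -> F b = 0) ->
  \sum_(b < n) F b = \sum_(b < W) F b.
Proof.
move=> nW F0; rewrite (big_ord_widen W F nW) [RHS](bigID (fun b : 'I_W => (b < n)%N)) /=.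
by rewrite [X in _ = _ + X]big1 ?addr0 // => b nb; apply: F0; rewrite // leqNgt.
Qed.

Lemma straight_stab G n W x : (n <= W)%N -> vacuum_from n x -> straight G n x = straight G W x.
Proof.
move=> nW tx; apply/malgP => ka; rewrite !straight_coeff; case: leqP => kan.
  by rewrite (leq_trans kan nW) (match_det_stab kan nW).
by case: leqP => // kaW; rewrite (@match_det_small n) //; apply: leq_trans kaW.
Qed.

(** The operator that adds [k] to one entry in all ways: multiplication by p_k
    for k > 0, the adjoint of multiplication by p_(-k) for k < 0.  Entries at the
    places from [size la + absz k] on contribute nothing, as the modified entry
    then coincides with another entry of the tail. *)
Definition ribbon (k : int) (la : intpart) : Lambda :=
  let n := (size (parts la) + absz k)%N in
  \sum_(b < n) straight int n (shift_at (maya_seq la) b k).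

Lemma shift_tail n x b k : vacuum_from n x -> (b < n)%N -> vacuum_from n (shift_at x b k).
Proof. by move=> tx bn i ni; rewrite /shift_at ifF ?tx //; apply/eqP; lia. Qed.

Lemma vacuum_fromW n W x : (n <= W)%N -> vacuum_from n x -> vacuum_from W x.
Proof. by move=> nW tx i Wi; apply: tx; apply: leq_trans Wi. Qed.

Lemma maya_seq_tailW (la : intpart) W : (size la <= W)%N -> vacuum_from W (maya_seq la).
Proof. by move=> laW; apply: vacuum_fromW laW (@maya_seq_tail la). Qed.

(** The modified entry repeats the one at the place b - k, or falls below the
    window. *)
Lemma match_det_shift_tail0 W (la : intpart) b (k : int) y : k != 0 ->
  (size la + absz k <= b)%N -> (b < W)%N ->
  (forall j, (j < W)%N -> - W%:Z <= y j) -> match_det W (shift_at (maya_seq la) b k) y = 0.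
Proof.
move=> k0 lab bW yge.
have xb : shift_at (maya_seq la) b k b = - b.+1%:Z + k.
  by rewrite /shift_at eqxx maya_seq_tail //; lia.
have [cW|Wc] := ltP (b%:Z - k) W%:Z; last first.
  by apply: (match_det_row0 bW) => j jW; have := yge j jW; rewrite xb; lia.
have cE : (absz (b%:Z - k))%:Z = b%:Z - k by lia.
apply: (@match_det_alt _ _ _ b (absz (b%:Z - k))) => //; try lia.
rewrite xb /shift_at ifF; last by apply/eqP; lia.
by rewrite maya_seq_tail; lia.
Qed.

Lemma maya_seq_geW (la : intpart) W j : (j < W)%N -> - W%:Z <= maya_seq la j.
Proof. by have := maya_seq_ge la j; lia. Qed.

(** The coefficients of a ribbon operator can be computed in any sufficiently
    large window. *)
Lemma ribbon_coeff W (k : int) (la mu : intpart) : k != 0 -> (size la + absz k <= W)%N ->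
  (size mu <= W)%N ->
  (ribbon k la)@_mu = \sum_(b < W) match_det W (shift_at (maya_seq la) b k) (maya_seq mu).
Proof.
move=> k0 laW muW; rewrite /ribbon raddf_sum.
rewrite -(sum_widen (F := fun b => match_det W (shift_at (maya_seq la) b k) (maya_seq mu)) laW).
  apply: eq_bigr => b _ /=; rewrite straight_coeff intz.
  have tx : vacuum_from (size la + absz k) (shift_at (maya_seq la) b k).
    by apply: shift_tail => //; apply: maya_seq_tailW; exact: leq_addr.
  case: leqP => mun; first by rewrite (match_det_stab mun laW).
  by rewrite (@match_det_small (size la + absz k)) //; apply: leq_trans muW.
move=> b lab bW; apply: match_det_shift_tail0 => // j; exact: maya_seq_geW.
Qed.

Lemma match_det_shift_adj W x y k :
  \sum_(b < W) match_det W (shift_at x b k) y = \sum_(b < W) match_det W x (shift_at y b (- k)).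
Proof.
have := @sum_det_row_col _ W (\matrix_(i, j) (x i == y j)%:R)
  (\matrix_(i, j) (x i + k == y j)%:R : 'M[int]_W).
rewrite (eq_bigr (fun b : 'I_W => match_det W (shift_at x b k) y)) => [->|b _]; last first.
  congr (\det _); apply/matrixP => i j; rewrite !mxE /shift_at -(inj_eq val_inj) /=.
  by case: eqP.
apply: eq_bigr => b _.
congr (\det _); apply/matrixP => i j; rewrite !mxE /shift_at -(inj_eq val_inj) /=.
by case: eqP => // _; congr (_%:R); rewrite -subr_eq opprK.
Qed.

Lemma ribbon_adj k (la mu : intpart) : k != 0 -> (ribbon k la)@_mu = (ribbon (- k) mu)@_la.
Proof.
move=> k0; pose W := (size la + size mu + absz k)%N.
rewrite (@ribbon_coeff W) /W ?oppr_eq0 //; try lia.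
rewrite (@ribbon_coeff W) /W ?oppr_eq0 //; try lia.
rewrite match_det_shift_adj; apply: eq_bigr => b _; exact: match_detC.
Qed.

Lemma sum_maya_seq W (la : intpart) : (size la <= W)%N ->
  \sum_(i < W) maya_seq la i = (psize la)%:Z - \sum_(i < W) i.+1%:Z.
Proof.
move=> laW; rewrite /maya_seq sumrB; congr (_ - _).
rewrite /psize sumnE (big_nth 0%N) big_mkord.
rewrite -(sum_widen (F := fun i => (nth 0%N la i)%:Z) laW).
  by rewrite -natz natr_sum; apply: eq_bigr => i _; rewrite natz.
by move=> b lab _; rewrite nth_default.
Qed.

Lemma sum_shift W x b k : (b < W)%N ->
  \sum_(i < W) shift_at x b k i = \sum_(i < W) x i + k.
Proof.
move=> bW; rewrite (bigD1 (Ordinal bW)) //= [in RHS](bigD1 (Ordinal bW)) //=.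
rewrite /shift_at eqxx -!addrA; congr (_ + _); rewrite [RHS]addrC; congr (_ + _).
apply: eq_bigr => i ib; rewrite ifF //; apply/negbTE.
by rewrite -(inj_eq val_inj) in ib.
Qed.

Lemma ribbon_degree k (la mu : intpart) : k != 0 -> (ribbon k la)@_mu != 0 ->
  (psize mu)%:Z = (psize la)%:Z + k.
Proof.
move=> k0; pose W := (size la + size mu + absz k)%N.
have laW : (size la <= W)%N by rewrite /W; lia.
have muW : (size mu <= W)%N by rewrite /W; lia.
rewrite (@ribbon_coeff W) //; last by rewrite /W; lia.
move=> nz; have [b] : exists b : 'I_W, match_det W (shift_at (maya_seq la) b k) (maya_seq mu) != 0.
  apply: contrapT => H; case/eqP: nz; rewrite big1 // => b _.
  by apply/eqP/negP => /negP nb; apply: H; exists b.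
move=> /match_det_sum; rewrite sum_shift // !sum_maya_seq //.
move: (\sum_(i < W) _) => t; lia.
Qed.

Lemma antisym_shift W k y :
  antisym W (fun x => \sum_(c < W) match_det W (shift_at x c k) y).
Proof.
apply: antisym_int => x x' s e; rewrite mulr_sumr [RHS](reindex_inj (@perm_inj _ s)).
apply: eq_bigr => c _; apply: det_row_perm => i j; rewrite !mxE.
congr (_%:R); rewrite /shift_at !(inj_eq val_inj) (inj_eq perm_inj) e.
by [].
Qed.

(** Composing two ribbon operators modifies two entries, possibly the same one.
    The condition j + k <> 0 is what makes the terms beyond the window vanish: for
    j + k = 0 an entry of the tail can be moved and moved back, and the
    operators satisfy the Heisenberg relation instead of commuting. *)
Lemma ribbon2_coeff W (j k : int) (la mu : intpart) : j != 0 -> k != 0 -> j + k != 0 ->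
  (size la + 2 * absz k + 2 * absz j <= W)%N -> (size mu <= W)%N ->
  (lin_ext (ribbon j) (ribbon k la))@_mu =
  \sum_(b < W) \sum_(c < W) match_det W (shift_at (shift_at (maya_seq la) b k) c j) (maya_seq mu).
Proof.
move=> j0 k0 jk laW muW; rewrite mcoeff_lin_ext /ribbon raddf_sum.
set n := (size la + absz k)%N.
have nW : (n <= W)%N by rewrite /n; lia.
rewrite -(sum_widen (F := fun b => \sum_(c < W)
   match_det W (shift_at (shift_at (maya_seq la) b k) c j) (maya_seq mu)) nW).
  apply: eq_bigr => b _ /=.
  have tx : vacuum_from n (shift_at (maya_seq la) b k).
    by apply: shift_tail => //; apply: maya_seq_tailW; exact: leq_addr.
  rewrite (straight_stab _ nW tx).
  apply: (lsum_straight (n := n) (antisym_shift W j (maya_seq mu))) => //.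
    by move=> ka kan; apply: ribbon_coeff => //; rewrite /n in kan; lia.
  move=> i iW; have := maya_seq_ge la i; rewrite /shift_at; have := ltn_ord b; rewrite /n.
  by case: eqP => [->|_]; lia.
move=> b nb bW; have bla : (size la <= b)%N by rewrite /n in nb; lia.
have lo i : (i < W)%N -> - W%:Z <= maya_seq mu i by exact: maya_seq_geW.
have xb : maya_seq la b = - b.+1%:Z by rewrite maya_seq_tail.
have [cW|Wc] := ltP (b%:Z - k) W%:Z.
  have cE : (absz (b%:Z - k))%:Z = b%:Z - k by rewrite /n in nb; lia.
  have cW' : (absz (b%:Z - k) < W)%N by lia.
  apply: (proj2 (antisym_shift W j (maya_seq mu)) _ (Ordinal bW) (Ordinal cW')).
    by rewrite -(inj_eq val_inj) /=; apply/eqP; lia.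
  rewrite /shift_at /= eqxx ifF; last by apply/eqP; lia.
  by rewrite xb maya_seq_tail; rewrite /n in nb; lia.
rewrite big1 // => c _.
have [cb|cb] := eqVneq (c : nat) b; last first.
  apply: (match_det_row0 bW) => i iW; have := lo i iW.
  rewrite /shift_at eqxx ifF; last by apply/eqP => bc; rewrite bc eqxx in cb.
  by rewrite xb; lia.
have -> : match_det W (shift_at (shift_at (maya_seq la) b k) c j) (maya_seq mu) =
          match_det W (shift_at (maya_seq la) b (j + k)) (maya_seq mu).
  by apply: eq_match_det => // i _; rewrite /shift_at cb; case: eqP => //; lia.
apply: match_det_shift_tail0 => //.
rewrite /n in nb; lia.
Qed.
Lemma ribbon_comm (j k : int) la : j != 0 -> k != 0 -> j + k != 0 ->
  lin_ext (ribbon j) (ribbon k la) = lin_ext (ribbon k) (ribbon j la).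
Proof.
move=> j0 k0 jk; apply/malgP => mu.
pose W := (size (parts la) + 2 * absz k + 2 * absz j + size (parts mu))%N.
rewrite (@ribbon2_coeff W) //; try by rewrite /W; lia.
rewrite (@ribbon2_coeff W) //; try by rewrite /W; lia.
rewrite exchange_big; apply: eq_bigr => b _; apply: eq_bigr => c _.
apply: eq_match_det => // i _; rewrite /shift_at.
by case: eqP => //; case: eqP => //; rewrite addrAC.
Qed.

(** * Power sums as ribbon operators *)

Lemma hallE f g : hall f g = lsum (fun k => g@_k) f.
Proof. by rewrite /hall mmapE; apply: eq_bigr => k _; rewrite intz. Qed.

Lemma hallC f g : hall f g = hall g f.
Proof.
rewrite !hallE; pose E := (msupp f `|` msupp g)%fset.
rewrite (mmapEw (d := E)) ?(mmapEw (d := E)) //.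
- by apply: eq_bigr => k _; rewrite /= !intz mulrC.
- exact: fsubsetUr.
- exact: fsubsetUl.
Qed.

Lemma hallU f la : hall f << la >> = f@_la.
Proof. by rewrite hallC hallE mmapU mul1r. Qed.

Lemma hall_adj (S S' : intpart -> Lambda) f g :
  (forall la mu, (S la)@_mu = (S' mu)@_la) ->
  hall (lin_ext S f) g = hall f (lin_ext S' g).
Proof.
move=> adj; rewrite hallC !hallE.
rewrite !mmapE (eq_bigr (fun k => \sum_(h <- msupp f) g@_k * (f@_h * (S h)@_k))).
  rewrite exchange_big; apply: eq_bigr => h _.
  rewrite mcoeff_lin_ext mmapE intz mulr_sumr; apply: eq_bigr => k _.
  by rewrite intz adj; ring.
move=> k _; rewrite mcoeff_lin_ext mmapE intz mulr_sumr.
by apply: eq_bigr => h _; rewrite intz.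
Qed.

(** A module, so that the notations for polynomials, which clash with those for
    {malg G[K]}, stay local. *)
Module AlternantIndep.
Import mpoly.

(** The alternant as a polynomial, where coefficients of monomials make sense. *)
Definition palt N (e : 'I_N -> nat) : mpoly N int :=
  \det (\matrix_(i < N, j < N) 'X_j ^+ e i).

Lemma alternantE N (e : 'I_N -> nat) : alternant e = FracField.tofrac (palt e).
Proof.
rewrite /alternant /palt -det_map_mx; congr (\det _).
by apply/matrixP => i j; rewrite !mxE rmorphXn.
Qed.

(** The coefficient of x^k in an alternant is again a matching determinant. *)
Lemma palt_coeff N (e k : 'I_N -> nat) :
  mcoeff [multinom k i | i < N] (palt e) = \det (\matrix_(i, j) (e i == k j)%:R).
Proof.
rewrite /palt /determinant raddf_sum; apply: eq_bigr => s _ /=.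
rewrite -[(-1) ^+ s in LHS](rmorph_sign (@mpolyC N int)) mcoeffCM.
congr (_ * _).
have -> : \prod_i (\matrix_(i0, j) ('X_j ^+ e i0 : mpoly N int)) i (s i) =
   'X_[ [multinom e ((s^-1)%g i) | i < N] ].
  rewrite (mpolyXE _ s); apply: eq_bigr => i _.
  by rewrite mxE mnmE permK.
rewrite mcoeffX.
transitivity ([forall i, e i == k (s i)]%:R : int).
  congr (_%:R); congr nat_of_bool; apply/eqP/forallP.
    by move=> /mnmP h i; have := h (s i); rewrite !mnmE permK => ->.
  by move=> h; apply/mnmP => i; rewrite !mnmE (eqP (h _)) permKV.
case: forallP => [h|h].
  by rewrite big1 // => i _; rewrite mxE h.
have /existsNP[i ne] : ~ (forall i, e i == k (s i)) by [].
by rewrite (bigD1 i) //= mxE (negPf (introN idP ne)) mul0r.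
Qed.

Lemma alternant_indep N (I : Type) (r : seq I) (c : I -> int)
    (e : I -> 'I_N -> nat) (k : 'I_N -> nat) :
  \sum_(i <- r) (c i)%:~R * alternant (e i) = 0 ->
  \sum_(i <- r) c i * \det (\matrix_(a, b) (e i a == k b)%:R) = 0.
Proof.
move=> e0.
have p0 : \sum_(i <- r) (c i)%:~R * palt (e i) = 0.
  apply/eqP; rewrite -tofrac_eq0 -e0 rmorph_sum; apply/eqP.
  by apply: eq_bigr => i _; rewrite rmorphM rmorph_int alternantE.
have := congr1 (mcoeff [multinom k i | i < N]) p0; rewrite mcoeff0 raddf_sum => h.
rewrite -[RHS]h; apply: eq_bigr => i _ /=.
by rewrite -[in RHS](rmorph_int (@mpolyC N int)) mcoeffCM palt_coeff intz.
Qed.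

End AlternantIndep.
Lemma lsumZ (V : nzRingType) (g : intpart -> V) c (u : Lambda) :
  lsum g (c *: u) = c%:~R * lsum g u.
Proof. by rewrite -[c in LHS]intz scaler_int raddfMz mulrzl. Qed.

Lemma lsum_lin_ext (V : nzRingType) (g : intpart -> V) S (f : Lambda) :
  lsum g (lin_ext S f) = lsum (fun k => lsum g (S k)) f.
Proof.
rewrite /lin_ext raddf_sum [RHS]mmapE; apply: eq_bigr => k _ /=.
exact: lsumZ.
Qed.

Lemma lsum_mulr (V : comNzRingType) (g : intpart -> V) c f :
  lsum (fun k => c * g k) f = c * lsum g f.
Proof.
by rewrite !mmapE mulr_sumr; apply: eq_bigr => k _; rewrite mulrCA.
Qed.

Lemma eq_lsum (V : nzRingType) (g g' : intpart -> V) f :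
  (forall k, k \in msupp f -> g k = g' k) -> lsum g f = lsum g' f.
Proof. by move=> e; rewrite !mmapE; apply: eq_big_seq => k /e ->. Qed.

(** The numerator of a Schur polynomial as a function of a sequence: adding [N]
    to the entries of the maya sequence gives the exponents la_i + N - i. *)
Definition alt_seq N (x : nat -> int) : sfield N :=
  alternant (fun i : 'I_N => absz (x i + N%:Z)).

Definition weyl_denominator N : sfield N := alternant (fun i : 'I_N => N - i.+1)%N.

Lemma sym_evalE N f : sym_eval N f = lsum (schur_poly N) f.
Proof. by []. Qed.

Lemma schur_maya_seq N (la : intpart) : (size la <= N)%N ->
  schur_poly N la = alt_seq N (maya_seq la) / weyl_denominator N.
Proof.
move=> laN; rewrite /schur_poly laN; congr (_ / _); congr (\det _).
apply/matrixP => i j; rewrite !mxE; congr (_ ^+ _).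
by have := ltn_ord i; rewrite /maya_seq; lia.
Qed.

Lemma antisym_alt N : antisym N (fun x => alt_seq N x / weyl_denominator N).
Proof.
split=> [x x' s e|x i j ij e].
  rewrite mulrA; congr (_ / _); apply: det_row_perm => i j.
  by rewrite !mxE e.
suff -> : alt_seq N x = 0 by rewrite mul0r.
by apply: (determinant_alternate ij) => k; rewrite !mxE e.
Qed.

(** Multiplying a column of the matrix x_j^(e_a) by x_j^k raises all exponents of
    this column by k; by [sum_det_row_col] this can be done row by row instead. *)
Lemma psum_alt N x k : (forall i, (i < N)%N -> - N%:Z <= x i) ->
  \sum_(b < N) alt_seq N (shift_at x b k%:Z) = (\sum_(j < N) svar j ^+ k) * alt_seq N x.
Proof.
move=> lo.
have := @sum_det_row_col _ N (\matrix_(i, j) svar j ^+ absz (x i + N%:Z))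
  (\matrix_(i, j) svar j ^+ (absz (x i + N%:Z) + k)).
rewrite (eq_bigr (fun b : 'I_N => alt_seq N (shift_at x b k%:Z))) => [->|b _]; last first.
  congr (\det _); apply/matrixP => i j; rewrite !mxE /shift_at -(inj_eq val_inj) /=.
  case: eqP => // _; congr (_ ^+ _); have := lo i (ltn_ord i); lia.
rewrite mulr_suml; apply: eq_bigr => b _.
rewrite -[alt_seq _ _]mul1r.
have <- : \det (diag_mx (\row_j if j == b then svar j ^+ k else 1)) = svar b ^+ k.
  rewrite det_diag (bigD1 b) //= mxE eqxx big1 ?mulr1 // => j jb.
  by rewrite mxE (negPf jb).
rewrite mul1r mulrC /alt_seq -det_mulmx; congr (\det _).
rewrite mul_mx_diag; apply/matrixP => i j; rewrite !mxE.
by case: eqP => _; rewrite ?mulr1 // exprD.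
Qed.

(** The entry -(b+1) of the tail of [mu] was removed from [la] and is matched by
    nothing. *)
Lemma match_det_unmatched W (la mu : intpart) b (k : int) : k != 0 ->
  (size la <= b)%N -> (size mu <= b)%N -> (b < W)%N ->
  match_det W (shift_at (maya_seq la) b k) (maya_seq mu) = 0.
Proof.
move=> k0 lab mub bW; apply: (match_det_col0 bW) => i iW.
rewrite (maya_seq_tail mub) /shift_at -(maya_seq_tail lab).
have [->|ib] := eqVneq i b; last by rewrite (inj_eq (@maya_seq_inj la)).
by rewrite -subr_eq0 addrAC subrr add0r.
Qed.

(** Adding a ribbon cannot shorten a partition.  With fewer than [N] variables
    than parts, this is why both sides of the product formula vanish. *)
Lemma ribbon_size i (la mu : intpart) : (0 < i)%N -> (ribbon i%:Z la)@_mu != 0 ->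
  (size la <= size mu)%N.
Proof.
move=> i0; apply: contraNT; rewrite -ltnNge => mula.
have k0 : i%:Z != 0 by lia.
rewrite (@ribbon_coeff (size la + i + size mu)) //; try lia.
apply/eqP; apply: big1 => b _.
have [lab|bla] := leqP (size la) b.
  by apply: match_det_unmatched => //; lia.
(* the entry - size la is taken by the tail of mu but skipped by la *)
apply: (@match_det_col0 _ _ _ (size la).-1); first by lia.
move=> a aW; rewrite (maya_seq_tail (la := mu)); last by lia.
rewrite /shift_at; have [al|la_a] := ltnP a (size la).
  have := nth_part_gt0 al; rewrite /maya_seq.
  by case: (a == b); lia.
rewrite ifF; last by apply/eqP; lia.
by rewrite maya_seq_tail //; lia.
Qed.

Lemma lsum_schur_ext N (f g : Lambda) :
  (forall mu : intpart, (size mu <= N)%N -> f@_mu = g@_mu) ->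
  lsum (schur_poly N) f = lsum (schur_poly N) g.
Proof.
move=> fg; apply/eqP; rewrite -subr_eq0 -raddfB; apply/eqP.
rewrite /= mmapE big_seq big1 // => k; rewrite -mcoeff_neq0 mcoeffB => nz.
rewrite /schur_poly; case: leqP => [kN|_]; last by rewrite mulr0.
by rewrite fg // subrr eqxx in nz.
Qed.

(** The Murnaghan-Nakayama rule, for every number [N] of variables.  Partitions
    with more than [N] parts have Schur polynomial 0, so the window of the ribbon
    operator can be cut down to [N], where the rule is [psum_alt]. *)
Lemma schur_ribbon N i (la : intpart) : (0 < i)%N ->
  lsum (schur_poly N) (ribbon i%:Z la) = (\sum_(j < N) svar j ^+ i) * schur_poly N la.
Proof.
move=> i0; have k0 : i%:Z != 0 by lia.
have [laN|Nla] := leqP (size la) N; last first.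
  (* too few variables: both sides are 0 *)
  rewrite [in RHS]/schur_poly leqNgt Nla mulr0.
  rewrite (@lsum_schur_ext _ _ 0) ?mmap0 // => mu muN; rewrite mcoeff0.
  by apply/eqP; apply: contraTT muN => /(ribbon_size i0); lia.
rewrite (@lsum_schur_ext N _ (\sum_(b < N) straight int N (shift_at (maya_seq la) b i%:Z))).
  rewrite raddf_sum schur_maya_seq // mulrA -psum_alt; last by move=> b; exact: maya_seq_geW.
  rewrite mulr_suml; apply: eq_bigr => b _.
  apply: (lsum_straight (n := N) (antisym_alt N)) => //.
  - by apply: shift_tail => //; exact: maya_seq_tailW.
  - by move=> ka; exact: schur_maya_seq.
  by move=> a aN; have := maya_seq_geW la aN; rewrite /shift_at; case: eqP => _; lia.
move=> mu muN; rewrite (@ribbon_coeff (size la + i + N)) //; try lia.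
rewrite [RHS]raddf_sum.
rewrite -(sum_widen (F := fun b => match_det (size la + i + N) (shift_at (maya_seq la) b i) (maya_seq mu)) (n := N)).
- apply: eq_bigr => b _ /=; rewrite straight_coeff muN intz; apply: match_det_stab => //; first by lia.
  by apply: shift_tail => //; exact: maya_seq_tailW.
- by lia.
by move=> b Nb bW; apply: match_det_unmatched => //; lia.
Qed.

Lemma sym_eval_ribbon N i f : (0 < i)%N ->
  sym_eval N (lin_ext (ribbon i%:Z) f) = (\sum_(j < N) svar j ^+ i) * sym_eval N f.
Proof.
move=> i0; rewrite !sym_evalE lsum_lin_ext -lsum_mulr; apply: eq_lsum => la _.
exact: schur_ribbon.
Qed.

(** Schur polynomials are linearly independent: in enough variables, distinct
    partitions have distinct leading exponents. *)
Lemma sym_eval_inj f g : (forall N, sym_eval N f = sym_eval N g) -> f = g.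
Proof.
move=> fg; apply/eqP; rewrite -subr_eq0; apply/eqP; set h := f - g.
have h0 N : sym_eval N h = 0.
  by rewrite sym_evalE raddfB /= -!sym_evalE fg subrr.
apply/malgP => mu; rewrite mcoeff0.
pose N := (size mu + \sum_(ka <- msupp h) size (parts ka))%N.
have muN : (size mu <= N)%N by exact: leq_addr.
have kaN (ka : intpart) : ka \in msupp h -> (size ka <= N)%N.
  move=> kah; apply: leq_trans (leq_addl _ _).
  by rewrite (big_fsetD1 ka) //= leq_addr.
have vn0 : weyl_denominator N != 0.
  apply/eqP => v0.
  have := @AlternantIndep.alternant_indep N unit [:: tt] (fun=> 1)
    (fun _ i => N - i.+1)%N (fun i => N - i.+1)%N.
  rewrite !big_seq1 !mul1r => /(_ v0).
  have -> : \matrix_(a < N, b < N) (N - a.+1 == N - b.+1)%N%:R = 1%:M :> 'M[int]_N.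
    apply/matrixP => a b; rewrite !mxE -(inj_eq val_inj) /=; congr (_%:R).
    have := ltn_ord a; have := ltn_ord b => ? ?.
    by congr nat_of_bool; apply/eqP/eqP; lia.
  by rewrite det1.
have := h0 N; rewrite /sym_eval (eq_big_seq (fun ka =>
   (h@_ka)%:~R * alt_seq N (maya_seq ka) / weyl_denominator N)); last first.
  by move=> ka /kaN kN; rewrite schur_maya_seq // mulrA.
rewrite -mulr_suml => /eqP; rewrite mulf_eq0 invr_eq0 (negPf vn0) orbF => /eqP.
move=> /(AlternantIndep.alternant_indep (fun i => absz (maya_seq mu i + N%:Z))).
have E ka : \det (\matrix_(a < N, b < N)
    (absz (maya_seq ka a + N%:Z)%R == absz (maya_seq mu b + N%:Z)%R)%:R) = match_det N (maya_seq ka) (maya_seq mu) :> int.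
  congr (\det _); apply/matrixP => a b; rewrite !mxE; congr (_%:R).
  have := maya_seq_geW ka (ltn_ord a); have := maya_seq_geW mu (ltn_ord b).
  by move=> ? ?; congr nat_of_bool; apply/eqP/eqP; lia.
rewrite (eq_big_seq (fun ka => h@_ka * (ka == mu)%:R)); last first.
  by move=> ka /kaN kN; rewrite E match_det_maya_seq.
have [muh|/mcoeff_outdom-> //] := boolP (mu \in msupp h).
rewrite (big_fsetD1 mu) //= eqxx mulr1 big1_fset ?addr0 // => ka.
by rewrite in_fsetD1 => /andP[/negPf -> _]; rewrite mulr0.
Qed.

Lemma psum_mulE i f : (0 < i)%N -> psum_mul i f = lin_ext (ribbon i%:Z) f.
Proof.
move=> i0; apply: xget_unique => [N|g gP]; first exact: sym_eval_ribbon.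
by apply: sym_eval_inj => N; rewrite gP sym_eval_ribbon.
Qed.

Lemma psum_perpE i f : (0 < i)%N -> psum_perp i f = lin_ext (ribbon (- i%:Z)) f.
Proof.
move=> i0.
have adj la mu : (ribbon (- i%:Z) la)@_mu = (ribbon i%:Z mu)@_la.
  by rewrite ribbon_adj ?opprK //; lia.
apply: xget_unique => [h|g gP]; first by rewrite psum_mulE // (hall_adj _ _ adj).
apply/malgP => mu; rewrite -!hallU gP psum_mulE //.
by rewrite (hall_adj _ _ adj).
Qed.

(** * The coefficients of phi *)

Lemma fsbig_reindex (I : finType) (J : choiceType) (V : zmodType)
    (P : set J) (F : J -> V) (h : I -> J) (Q : pred I) :
  injective h -> (forall i, Q i <-> P (h i)) ->
  (forall a, P a -> F a != 0 -> exists i, h i = a) ->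
  \sum_(a \in P) F a = \sum_(i | Q i) F (h i).
Proof.
move=> hi QP FP; rewrite (fsbigE [seq h i | i <- enum I & Q i]).
- rewrite big_map big_filter_cond big_enum_cond /=; apply: eq_bigl => i.
  by apply/andb_idr => Qi; apply/mem_set/QP.
- by rewrite map_inj_uniq // filter_uniq // enum_uniq.
- move=> a /= /mapP; case=> i; rewrite mem_filter => /andP[Qi _] ->; exact/QP.
move=> a Pa; apply: contraNeq => nz; have [i e] := FP a Pa nz.
apply/mapP; exists i => //; rewrite mem_filter mem_enum andbT.
by apply/QP; rewrite e.
Qed.

(** The sequence a_(m-1), ..., a_0, x_0, x_1, ... *)
Definition prepend m (a x : nat -> int) (i : nat) : int :=
  if (i < m)%N then a (m - i.+1)%N else x (i - m)%N.

Definition coords m (a : m.-tuple int) (i : nat) : int := nth 0 a i.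

Lemma straighten_prepend G m (a : m.-tuple int) (la : intpart) W :
  (size la <= W)%N ->
  straighten G [seq y - m%:Z | y <- rev a ++ maya la] =
  straight G (m + W) (fun i => prepend m (coords a) (maya_seq la) i - m%:Z).
Proof.
move=> laW; rewrite -(@straight_stab _ (m + size la)%N) ?leq_add2l //; last first.
  move=> i mi; rewrite /prepend ifF; last by lia.
  rewrite maya_seq_tail; last by lia.
  by lia.
rewrite /straight; congr (straighten _ _).
have sz : size (rev a ++ maya la) = (m + size la)%N.
  by rewrite size_cat size_rev size_tuple size_mkseq.
apply: (@eq_from_nth _ 0); first by rewrite size_map size_mkseq.
move=> i; rewrite size_map sz => iW.
rewrite (nth_map 0) ?sz // nth_mkseq //; congr (_ - _).
rewrite nth_cat size_rev size_tuple /prepend; case: ltnP => im.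
  by rewrite nth_rev ?size_tuple.
by rewrite nth_mkseq //; lia.
Qed.

(** Translating the partition side by m replaces the operator -m on the sequence
    side. *)
Definition translate (m : nat) (y : nat -> int) (i : nat) : int := y i + m%:Z.

Lemma match_det_translate W m x y : match_det W (fun i => x i - m%:Z) y = match_det W x (translate m y).
Proof.
congr (\det _); apply/matrixP => i j; rewrite !mxE /translate; congr (_%:R).
by rewrite subr_eq.
Qed.

Lemma straighten_prepend_coeff G m (a : m.-tuple int) (la mu : intpart) W :
  (size la <= W)%N -> (size mu <= m + W)%N ->
  (straighten G [seq y - m%:Z | y <- rev a ++ maya la])@_mu =
  (match_det (m + W) (prepend m (coords a) (maya_seq la)) (translate m (maya_seq mu)))%:~R.
Proof.
by move=> laW muW; rewrite (straighten_prepend _ _ laW) straight_coeff muW match_det_translate.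
Qed.

Lemma straighten_ge G m (a : m.-tuple int) (la : intpart) (i : 'I_m) :
  straighten G [seq y - m%:Z | y <- rev a ++ maya la] != 0 ->
  - (size la)%:Z <= tnth a i.
Proof.
apply: contraNle => lt; rewrite (straighten_prepend _ _ (leqnn _)).
have im : (m - i.+1 < m)%N by have := ltn_ord i; lia.
rewrite (@straight_eq0 _ _ _ (m - i.+1)%N) //; first by lia.
rewrite /prepend im /coords.
have -> : (m - (m - i.+1).+1)%N = i by have := ltn_ord i; lia.
have aux (t : int) : t < - (size la)%:Z -> t - m%:Z < - (m + size la)%N%:Z by lia.
by apply: aux; rewrite -tnth_nth.
Qed.

(** The tuples that contribute to phi are bounded below, since no entry may
    repeat the tail, hence bounded above, since their sum is fixed.  They
    therefore lie in the finite box of side [K] starting at [- size la]. *)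
Section PhiSum.
Variables (m : nat) (k : int) (la : intpart).

Let S : int := (\sum_(i < m) i%:Z) - k * m%:Z.
Let K := (absz S + m * size la + size la).+1.
Let box (f : {ffun 'I_m -> 'I_K}) : m.-tuple int :=
  [tuple (f i : nat)%:Z - (size la)%:Z | i < m].

Lemma box_inj : injective box.
Proof.
move=> f g /(congr1 (fun t i => tnth t i)) e; apply/ffunP => i.
have := congr1 (fun u => u i) e; rewrite !tnth_mktuple => h.
by apply: val_inj => /=; lia.
Qed.

Lemma box_surj G (a : m.-tuple int) : phi_tuples m k a ->
  straighten G [seq y - m%:Z | y <- rev a ++ maya la] != 0 ->
  exists f, box f = a.
Proof.
move=> [_ aS] nz.
have lo (i : 'I_m) := straighten_ge i nz.
have hi (i : 'I_m) : tnth a i + (size la)%:Z < K%:Z.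
  have : \sum_(j < m | j != i) tnth a j >= - (m * size la)%N%:Z.
    apply: (@le_trans _ _ (\sum_(j < m | j != i) - (size la)%:Z)).
      rewrite sumrN sumr_const lerN2 -mulr_natl natz -PoszM lez_nat.
      by rewrite leq_mul2r (leq_trans (max_card _)) ?card_ord ?orbT.
    by apply: ler_sum => j _; exact: lo.
  move: aS; rewrite (bigD1 i) //= -/S /K.
  move: (\sum_(j < m | _) _) => t; lia.
pose f := [ffun i : 'I_m => inord (absz (tnth a i + (size la)%:Z)) : 'I_K].
exists f; apply: eq_from_tnth => i; rewrite tnth_mktuple ffunE inordK.
  by have := lo i; lia.
by have := lo i; have := hi i; lia.
Qed.

Let Q f := `[< phi_tuples m k (box f) >].

Lemma phi_box G : phi_maya G m k la =
  \sum_(f | Q f) straighten G [seq y - m%:Z | y <- rev (box f) ++ maya la].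
Proof.
apply: (fsbig_reindex (h := box)); first exact: box_inj.
  by move=> f; split => /asboolP.
exact: box_surj.
Qed.

(** Straightening has coefficients 0, 1 and -1, so phi is defined over the
    integers. *)
Lemma phi_maya_intr (G : nzRingType) mu :
  (phi_maya G m k la)@_mu = ((phi_maya int m k la)@_mu)%:~R.
Proof.
rewrite !phi_box !raddf_sum /=; apply: eq_bigr => f _.
have laW : (size la <= size la + size mu)%N by exact: leq_addr.
have muW : (size mu <= m + (size la + size mu))%N by lia.
apply: etrans (straighten_prepend_coeff G (box f) laW muW) _; congr (_%:~R).
by apply/esym; apply: etrans (straighten_prepend_coeff int (box f) laW muW) (intz _).
Qed.

Lemma phi_coeff_fs (mu : intpart) W : (size la <= W)%N -> (size mu <= m + W)%N ->
  (phi_maya int m k la)@_mu =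
  \sum_(a \in phi_tuples m k) match_det (m + W) (prepend m (coords a) (maya_seq la)) (translate m (maya_seq mu)).
Proof.
move=> laW muW; rewrite phi_box raddf_sum /=.
rewrite (fsbig_reindex (h := box) (Q := Q)).
- apply: eq_bigr => f _.
  exact: etrans (straighten_prepend_coeff int (box f) laW muW) (intz _).
- exact: box_inj.
- by move=> f; split => /asboolP.
move=> a Pa nz; apply: (@box_surj int) => //; apply: contraNneq nz => s0.
have := @straighten_prepend_coeff int _ a la mu W laW muW.
by rewrite s0 mcoeff0 intz => <-.
Qed.
End PhiSum.
Section Closed.
Variables (m W : nat) (cls : nat -> int -> bool).

(** The rows of index i < m test a condition [cls (m - i.+1)] on the column
    instead of equality with an entry: they stand for the sum of all entries
    a_(m-1-i) subject to this condition. *)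
Definition color_det (x y : nat -> int) : int :=
  \det (\matrix_(i < m + W, j < m + W)
    (if (i < m)%N then cls (m - i.+1)%N (y j) else x (i - m)%N == y j)%:R).

Definition column_tuple (y : nat -> int) (c : {ffun 'I_m -> 'I_(m + W)}) : m.-tuple int :=
  [tuple y (c i) | i < m].

Lemma coords_column_tuple y c (i : 'I_m) : coords (column_tuple y c) i = y (c i).
Proof. by rewrite /coords -tnth_nth tnth_mktuple. Qed.

(** Multilinearity in the first m rows. *)
Lemma color_det_expand (x y : nat -> int) :
  (forall i j : 'I_(m + W), y i = y j -> i = j) ->
  color_det x y = \sum_(c : {ffun 'I_m -> 'I_(m + W)} | [forall i : 'I_m, cls i (y (c i))])
     match_det (m + W) (prepend m (coords (column_tuple y c)) x) y.
Proof.
move=> yi; rewrite /color_det /match_det /determinant [RHS]exchange_big /=.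
apply: eq_bigr => s _; rewrite -mulr_sumr; congr (_ * _).
rewrite big_split_ord /=.
under eq_bigr do rewrite mxE /= ltn_ord.
under [X in _ * X]eq_bigr do rewrite mxE /= ltnNge leq_addr addKn /=.
under [RHS]eq_bigr => c _.
  rewrite big_split_ord /=.
  under eq_bigr do rewrite mxE /= /prepend ltn_ord.
  under [X in _ * X]eq_bigr do rewrite mxE /= /prepend ltnNge leq_addr addKn /=.
  over.
rewrite -mulr_suml; congr (_ * _).
rewrite (reindex_inj rev_ord_inj) /=.
rewrite (eq_bigr (fun i : 'I_m => \sum_(j < m + W)
  (cls i (y j) && (y j == y (s (lshift W (rev_ord i)))))%:R)); last first.
  move=> i _; rewrite (bigD1 (s (lshift W (rev_ord i)))) //= eqxx andbT big1 ?addr0.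
    by congr ((cls _ _)%:R); have := ltn_ord i; lia.
  move=> j jne; case: eqP => [/yi e|_]; last by rewrite andbF.
  by rewrite e eqxx in jne.
rewrite bigA_distr_bigA /= [RHS]big_mkcond; apply: eq_bigr => c _.
case: forallP => [h|].
  rewrite [RHS](reindex_inj rev_ord_inj) /=; apply: eq_bigr => i _.
  rewrite h /=.
  have -> : (m - (m - i.+1).+1)%N = i by have := ltn_ord i; lia.
  by rewrite coords_column_tuple.
move=> /existsNP [i /negP ni]; rewrite (bigD1 i) //= (negPf ni).
by rewrite mul0r.
Qed.

Lemma color_det_row_perm (x x' : nat -> int) (s : 'S_W) (y : nat -> int) :
  (forall i : 'I_W, x' i = x (s i)) -> color_det x' y = (-1) ^+ s * color_det x y.
Proof.
move=> e; pose C := \matrix_(i < m, j < m + W) (cls (m - i.+1)%N (y j))%:R : 'M[int]_(m, m + W).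
pose X (z : nat -> int) := \matrix_(i < W, j < m + W) (z i == y j)%:R : 'M[int]_(W, m + W).
have E z : color_det z y = \det (col_mx C (X z)).
  congr (\det _); apply/matrixP => i j; rewrite !mxE; case: splitP => k ik; rewrite mxE ik //.
  by rewrite addKn.
have -> : color_det x' y = \det (block_mx 1%:M 0 0 (perm_mx s) *m col_mx C (X x)).
  rewrite E mul_block_col mul1mx !mul0mx addr0 add0r; congr (\det (col_mx _ _)).
  by rewrite -row_permE; apply/matrixP => i j; rewrite !mxE e.
by rewrite det_mulmx det_lblock det1 mul1r det_perm -E.
Qed.

Lemma antisym_color_det y : antisym W (fun x => color_det x y).
Proof. by apply: antisym_int => x x' s; exact: color_det_row_perm. Qed.

Lemma antisym_color_det_col k x :
  antisym (m + W) (fun y => color_det x (translate k y)).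
Proof.
apply: antisym_int => y y' s e; rewrite /color_det -det_tr -[in RHS]det_tr.
by apply: det_row_perm => i j; rewrite !mxE /translate e.
Qed.

End Closed.

Definition has_residue m (i : nat) (v : int) : bool := (v == i%:Z %[mod m%:Z])%Z.

(** Modifying the columns by j is modifying the rows by j.  A row that tests for
    a residue becomes the row testing for another residue, which already occurs
    because m does not divide j; so only the rows of [x] contribute. *)
Lemma color_det_shift_adj m W x y j : (0 < m)%N -> ~~ (m %| absz j)%N ->
  \sum_(b < W) color_det m W (has_residue m) (shift_at x b j) y =
  \sum_(c < m + W) color_det m W (has_residue m) x (shift_at y c (- j)).
Proof.
move=> m0 mj.
have := @sum_det_row_col _ (m + W)
  (\matrix_(i, c) (if (i < m)%N then has_residue m (m - i.+1) (y c) else x (i - m)%N == y c)%:R)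
  (\matrix_(i, c) (if (i < m)%N then has_residue m (m - i.+1) (y c - j) else x (i - m)%N == y c - j)%:R : 'M[int]_(m + W)).
rewrite [X in _ = X -> _](eq_bigr (fun c : 'I_(m + W) =>
   color_det m W (has_residue m) x (shift_at y c (- j)))); last first.
  move=> c _; congr (\det _); apply/matrixP => i b; rewrite !mxE /shift_at -(inj_eq val_inj) /=.
  by case: (nat_of_ord b == c).
move=> <-; rewrite big_split_ord /= [X in _ = X + _]big1 ?add0r; last first.
  move=> i _.
  (* the row i, which tests for the residue t, becomes the row of t + j *)
  set t : int := (m - i.+1)%N.
  have tm0 : (0 <= (t + j) %% m%:Z)%Z by apply: modz_ge0; lia.
  have tm1 : ((t + j) %% m%:Z < m%:Z)%Z by apply: ltz_pmod; lia.
  pose i' := absz ((t + j) %% m%:Z)%Z.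
  have i'E : i'%:Z = ((t + j) %% m%:Z)%Z by rewrite /i'; lia.
  have i'm : (m - i'.+1 < m)%N by lia.
  apply: (@determinant_alternate _ _ _ (lshift W i) (lshift W (Ordinal i'm))).
    rewrite (inj_eq (@lshift_inj _ _)); apply: contraNneq mj => ei.
    have : t = i'%:Z by rewrite /t ei /=; lia.
    rewrite i'E => /eqP; rewrite -[X in X == _](@modz_small _ m%:Z); last first.
      by rewrite /t; have := ltn_ord i; lia.
    by rewrite eqz_mod_dvd opprD addNKr dvdzE abszN.
  move=> c; rewrite !mxE -!(inj_eq val_inj) /= eqxx ltn_ord i'm ifF; last first.
    apply/negbTE; apply: contraNneq mj => ei.
    have : t = i'%:Z by rewrite /t -ei /=; lia.
    rewrite i'E => /eqP; rewrite -[X in X == _](@modz_small _ m%:Z); last first.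
      by rewrite /t; have := ltn_ord i; lia.
    by rewrite eqz_mod_dvd opprD addNKr dvdzE abszN.
  have -> : (m - (m - i'.+1).+1)%N = i' by lia.
  congr (_%:R); rewrite /has_residue i'E modz_mod !eqz_mod_dvd.
  by congr (nat_of_bool (_ %| _)%Z); rewrite -/t; ring.
apply: eq_bigr => b _; congr (\det _); apply/matrixP => i c; rewrite !mxE.
rewrite /shift_at -(inj_eq val_inj) /=.
case: ltnP => im; first by rewrite ifF //; apply/eqP; lia.
have -> : (i - m == b)%N = (i == m + b :> nat)%N by apply/eqP/eqP; lia.
by case: (nat_of_ord i == _) => //; congr (_%:R); rewrite -subr_eq opprK.
Qed.
Definition phi_det m W (x y : nat -> int) : int := color_det m W (has_residue m) x (translate m y).

Lemma sum_prepend m W a x :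
  \sum_(i < m + W) prepend m a x i = \sum_(i < m) a i + \sum_(i < W) x i.
Proof.
rewrite big_split_ord /=; congr (_ + _).
  rewrite (reindex_inj rev_ord_inj) /=; apply: eq_bigr => i _.
  rewrite /prepend ifT; last by have := ltn_ord i; lia.
  by congr a; have := ltn_ord i; lia.
by apply: eq_bigr => i _; rewrite /prepend ltnNge leq_addr addKn.
Qed.

Lemma sum_succ n : 2 * \sum_(i < n) i.+1%:Z = n%:Z * (n%:Z + 1).
Proof.
elim: n => [|n IH]; first by rewrite big_ord0.
by rewrite big_ord_recr mulrDr IH /=; lia.
Qed.

(** The condition on the sum of the a_i only expresses that phi_k lowers the
    weight of partitions by k m. *)
Lemma prepend_weight m W k (a : nat -> int) (la mu : intpart) :
  (size la <= W)%N -> (size mu <= m + W)%N ->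
  \sum_(i < m + W) prepend m a (maya_seq la) i = \sum_(i < m + W) translate m (maya_seq mu) i ->
  (\sum_(i < m) a i == \sum_(i < m) i%:Z - k * m%:Z) =
  ((psize mu)%:Z + k * m%:Z == (psize la)%:Z).
Proof.
move=> laW muW.
have -> : \sum_(i < m + W) translate m (maya_seq mu) i = \sum_(i < m + W) maya_seq mu i + m%:Z *+ (m + W).
  by rewrite -[(m + W)%N in X in _ *+ X]card_ord -sumr_const -big_split.
rewrite sum_prepend !sum_maya_seq //.
have -> : \sum_(i < m) i%:Z = \sum_(i < m) i.+1%:Z - m%:Z.
  rewrite -[m%:Z in RHS]natz -[X in X%:R]card_ord -sumr_const -sumrB.
  by apply: eq_bigr => i _; rewrite -addn1 PoszD addrK.
have := sum_succ m; have := sum_succ W; have := sum_succ (m + W).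
move: (\sum_(i < m) i.+1%:Z) (\sum_(i < W) i.+1%:Z) (\sum_(i < m + W) i.+1%:Z).
move: (\sum_(i < m) a i) => S t1 t2 t3; rewrite -mulr_natr natz PoszD => h3 h2 h1 e.
apply/eqP/eqP; lia.
Qed.

(** Apart from the condition on the weight, all the integers of a residue class
    are allowed for each a_i, and the sum over them collapses to one
    determinant. *)
Lemma phi_coeff m k (la mu : intpart) W :
  (size la <= W)%N -> (size mu <= m + W)%N ->
  (phi_maya int m k la)@_mu =
  if (psize mu)%:Z + k * m%:Z == (psize la)%:Z then phi_det m W (maya_seq la) (maya_seq mu) else 0.
Proof.
move=> laW muW; rewrite (phi_coeff_fs k laW muW).
set y := translate m (maya_seq mu).
have yi : injective y by move=> i j /addIr /maya_seq_inj.
pose Q (c : {ffun 'I_m -> 'I_(m + W)}) := `[< phi_tuples m k (column_tuple y c) >].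
rewrite (fsbig_reindex (h := column_tuple y) (Q := Q)); first last.
- move=> a _ /match_det_perm[s e].
  exists [ffun i => s (lshift W (rev_ord i))]; apply: eq_from_tnth => i.
  rewrite tnth_mktuple ffunE -e /= /prepend ifT; last by have := ltn_ord i; lia.
  by rewrite /coords (tnth_nth 0); congr nth; have := ltn_ord i; lia.
- by move=> c; split => /asboolP.
- move=> c d /(congr1 (fun t i => tnth t i)) e; apply/ffunP => i.
  have := congr1 (fun u => u i) e; rewrite !tnth_mktuple => /yi.
  exact: val_inj.
have QE c : match_det (m + W) (prepend m (coords (column_tuple y c)) (maya_seq la)) y != 0 ->
    Q c = [forall i : 'I_m, has_residue m i (y (c i))] &&
      ((psize mu)%:Z + k * m%:Z == (psize la)%:Z).
  move=> /match_det_sum /(prepend_weight k laW muW) <-.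
  have sE : \sum_(i < m) coords (column_tuple y c) i = \sum_(i < m) tnth (column_tuple y c) i.
    by apply: eq_bigr => i _; rewrite coords_column_tuple tnth_mktuple.
  rewrite sE; apply/asboolP/andP => -[h1 h2]; split; try exact/eqP.
    by apply/forallP => i; apply/eqP; move: (h1 i); rewrite tnth_mktuple.
  by move=> i; rewrite tnth_mktuple; move/forallP: h1 => /(_ i) /eqP.
rewrite /phi_det color_det_expand; last by move=> i j /yi; exact: val_inj.
case: ifP => deg; last first.
  apply: big1 => c; have [->//|/QE ->] :=
    eqVneq (match_det (m + W) (prepend m (coords (column_tuple y c)) (maya_seq la)) y) 0.
  by rewrite deg andbF.
rewrite big_mkcond [RHS]big_mkcond; apply: eq_bigr => c _.
have [e|/QE ->] := eqVneq (match_det (m + W) (prepend m (coords (column_tuple y c)) (maya_seq la)) y) 0.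
  by rewrite e !if_same.
by rewrite deg andbT.
Qed.

Lemma phi_det_row0 m W x y a : (a < W)%N ->
  (forall j, (j < m + W)%N -> x a != translate m y j) -> phi_det m W x y = 0.
Proof.
move=> aW H; apply: (det_row0 (a := rshift m (Ordinal aW))) => j.
by rewrite mxE /= ltnNge leq_addr addKn /= (negPf (H _ _)).
Qed.

Lemma phi_det_shift_row0 m W (la mu : intpart) b (j : int) : j != 0 ->
  (size la + absz j <= b)%N -> (b < W)%N ->
  phi_det m W (shift_at (maya_seq la) b j) (maya_seq mu) = 0.
Proof.
move=> j0 lab bW.
have xb : shift_at (maya_seq la) b j b = - b.+1%:Z + j.
  by rewrite /shift_at eqxx maya_seq_tail //; lia.
have [cW|Wc] := ltP (b%:Z - j) W%:Z; last first.
  by apply: (phi_det_row0 bW) => i iW; have := maya_seq_ge mu i; rewrite /translate xb; lia.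
have cW' : (absz (b%:Z - j) < W)%N by lia.
apply: (proj2 (antisym_color_det _ _ _ _) _ (Ordinal bW) (Ordinal cW')).
  by rewrite -(inj_eq val_inj) /=; apply/eqP; lia.
rewrite /= xb /shift_at ifF; last by apply/eqP; lia.
by rewrite maya_seq_tail; lia.
Qed.

(** Either the modified column repeats another one, or the entry of [la] that
    matched it is no longer matched. *)
Lemma phi_det_shift_col0 m W (la mu : intpart) b (j : int) : j != 0 ->
  (size la + absz j <= W)%N -> (size mu + absz j <= b)%N -> (b < m + W)%N ->
  phi_det m W (maya_seq la) (shift_at (maya_seq mu) b j) = 0.
Proof.
move=> j0 laW mub bW.
have yb : shift_at (maya_seq mu) b j b = - b.+1%:Z + j.
  by rewrite /shift_at eqxx maya_seq_tail //; lia.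
have [cW|Wc] := ltP (b%:Z - j) (m + W)%N%:Z.
  have cW' : (absz (b%:Z - j) < m + W)%N by lia.
  apply: (proj2 (antisym_color_det_col _ _ _ _ _) _ (Ordinal bW) (Ordinal cW')).
    by rewrite -(inj_eq val_inj) /=; apply/eqP; lia.
  rewrite /= yb /shift_at ifF; last by apply/eqP; lia.
  by rewrite maya_seq_tail; lia.
apply: (@phi_det_row0 _ _ _ _ (b - m)%N); first by lia.
move=> c cW; rewrite maya_seq_tail; last by lia.
have mb : maya_seq mu b = - b.+1%:Z by rewrite maya_seq_tail //; lia.
rewrite /translate /shift_at; have [->|cb] := eqVneq c b; first by rewrite mb; lia.
have : maya_seq mu c != maya_seq mu b by rewrite (inj_eq (@maya_seq_inj mu)).
by rewrite mb; lia.
Qed.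

Lemma ribbon_supp_size j la ka : (ribbon j la)@_ka != 0 ->
  (size (parts ka) <= size (parts la) + absz j)%N.
Proof.
apply: contraNT; rewrite -ltnNge /ribbon raddf_sum => lt; apply/eqP.
by apply: big1 => b _ /=; rewrite straight_coeff leqNgt lt.
Qed.

Lemma lsum_ribbon W j (la : intpart) (g : intpart -> int) G :
  antisym W G -> (forall ka : intpart, (size ka <= size la + absz j)%N -> g ka = G (maya_seq ka)) ->
  (size la + 2 * absz j <= W)%N ->
  (forall b, (size la + absz j <= b)%N -> (b < W)%N -> G (shift_at (maya_seq la) b j) = 0) ->
  lsum g (ribbon j la) = \sum_(b < W) G (shift_at (maya_seq la) b j).
Proof.
move=> Ga gG laW G0; rewrite /ribbon raddf_sum.
have nW : (size la + absz j <= W)%N by lia.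
rewrite -(sum_widen (F := fun b => G (shift_at (maya_seq la) b j)) nW G0).
apply: eq_bigr => b _ /=.
have tx : vacuum_from (size la + absz j) (shift_at (maya_seq la) b j).
  by apply: shift_tail => //; apply: maya_seq_tailW; exact: leq_addr.
rewrite (straight_stab _ nW tx); apply: (lsum_straight Ga nW tx gG) => i iW.
have := maya_seq_ge la i; rewrite /shift_at; have := ltn_ord b.
by case: eqP => [->|_]; lia.
Qed.

(** On either side the coefficient is a sum of determinants, with a row modified
    by j on the left and, after passing to the adjoint ribbon operator, a column
    modified by -j on the right. *)
Lemma phi_ribbon_comm m k j (la : intpart) : (0 < m)%N -> ~~ (m %| absz j)%N ->
  lin_ext (phi_maya int m k) (ribbon j la) = lin_ext (ribbon j) (phi_maya int m k la).
Proof.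
move=> m0 mj.
have j0 : j != 0 by apply: contraNneq mj => ->; rewrite dvdn0.
apply/malgP => mu.
pose W := (size la + size mu + 2 * absz j)%N.
pose D := (psize mu)%:Z + k * m%:Z == (psize la)%:Z + j.
transitivity (if D then \sum_(b < W) phi_det m W (shift_at (maya_seq la) b j) (maya_seq mu) else 0).
  rewrite mcoeff_lin_ext.
  rewrite (@eq_lsum _ _ (fun ka => if D then phi_det m W (maya_seq ka) (maya_seq mu) else 0)).
    case: ifP => _; last by rewrite mmapE big1 // => ka _; rewrite mulr0.
    apply: (lsum_ribbon (antisym_color_det _ _ _ _)) => //; first by rewrite /W; lia.
    by move=> b lb bW; exact: phi_det_shift_row0.
  move=> ka; rewrite -mcoeff_neq0 => nz.
  have := ribbon_supp_size nz; have := ribbon_degree j0 nz => deg sz.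
  rewrite (@phi_coeff _ _ _ _ W); try by rewrite /W; lia.
  by rewrite deg.
transitivity (if D then \sum_(b < m + W) phi_det m W (maya_seq la) (shift_at (maya_seq mu) b (- j)) else 0).
  case: ifP => // _; rewrite /phi_det color_det_shift_adj //; apply: eq_bigr => c _.
  congr color_det; apply/funext => i; rewrite /translate /shift_at.
  by case: ifP => // _; rewrite addrAC.
rewrite mcoeff_lin_ext; symmetry.
have nj0 : - j != 0 by rewrite oppr_eq0.
rewrite (@eq_lsum _ _ (fun ka => (ribbon (- j) mu)@_ka)); last first.
  by move=> ka _; exact: ribbon_adj.
rewrite -hallE hallC hallE.
rewrite (@eq_lsum _ _ (fun ka => if D then phi_det m W (maya_seq la) (maya_seq ka) else 0)).
  case: ifP => _; last by rewrite mmapE big1 // => ka _; rewrite mulr0.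
  apply: (lsum_ribbon (antisym_color_det_col _ _ _ _ _)) => //; first by rewrite /W; lia.
  by move=> b lb bW; apply: phi_det_shift_col0 => //; rewrite /W; lia.
move=> ka; rewrite -mcoeff_neq0 => nz.
have := ribbon_supp_size nz; have := ribbon_degree nj0 nz => deg sz.
rewrite (@phi_coeff _ _ _ _ W); try by rewrite /W; lia.
have -> : D = ((psize ka)%:Z + k * m%:Z == (psize la)%:Z) => //.
by rewrite deg /D; apply/eqP/eqP; lia.
Qed.

(** * The vacuum coefficient of phi *)

Lemma match_det_block m W X Y :
  (forall i, (i < m)%N -> X i = Y i) ->
  (forall i j, (i < m + W)%N -> (j < m + W)%N -> Y i = Y j -> i = j) ->
  match_det (m + W) X Y = match_det W (fun i => X (m + i)%N) (fun i => Y (m + i)%N).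
Proof.
move=> XY Yi.
rewrite [LHS](_ : _ = \det (block_mx 1%:M 0
   (\matrix_(i < W, j < m) (X (m + i)%N == Y j)%:R)
   (\matrix_(i < W, j < W) (X (m + i)%N == Y (m + j)%N)%:R))).
  by rewrite det_lblock det1 mul1r.
congr (\det _); apply/matrixP => i j; rewrite !mxE.
have Ye (a b : 'I_(m + W)) : (Y a == Y b) = (a == b :> nat).
  by apply/eqP/eqP => [/Yi-> //|->].
case: splitP => a ia; rewrite mxE; case: splitP => b jb; rewrite mxE ?ia ?jb //.
  by rewrite XY // -ia -jb Ye ia jb.
rewrite XY // -ia -jb Ye ia jb; case: eqP => // ab.
by have := ltn_ord a; lia.
Qed.

(** The only tuples that contribute to the coefficient of the empty partition. *)
Definition bumped m (i0 : 'I_m) : m.-tuple int :=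
  [tuple i%:Z - m%:Z *+ (i == i0) | i < m].

Lemma coords_bumped m (i0 i : 'I_m) :
  coords (bumped i0) i = i%:Z - m%:Z *+ (i == i0).
Proof. by rewrite /coords -tnth_nth tnth_mktuple. Qed.

(** Swapping the columns of the values i0 and i0 - m puts the entries of the tuple
    on the diagonal and leaves the empty partition with an m-ribbon added. *)
Lemma bumped_coeff m W (i0 : 'I_m) (x : nat -> int) : (m <= W)%N ->
  match_det (m + W) (prepend m (coords (bumped i0)) x) (translate m (maya_seq part0)) =
  - match_det W (shift_at (maya_seq part0) (rev_ord i0) m%:Z) x.
Proof.
move=> mW; set b := nat_of_ord (rev_ord i0).
have bE : b = (m - i0.+1)%N by [].
have i0m := ltn_ord i0.
have h1 : (b < m + W)%N by lia.
have h2 : (m + b < m + W)%N by lia.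
pose s := tperm (Ordinal h1) (Ordinal h2).
set y := translate m (maya_seq part0).
have yE j : y j = m%:Z - j.+1%:Z by rewrite /y /translate maya_seq_tail //; lia.
pose y' j := if j == b then y (m + b)%N else if j == (m + b)%N then y b else y j.
have y's (j : 'I_(m + W)) : y' j = y (s j).
  rewrite /y' /s; case: tpermP => [->|->|/eqP n1 /eqP n2] /=.
  - by rewrite eqxx.
  - by rewrite eqxx ifF //; apply/eqP; lia.
  by rewrite -!(inj_eq val_inj) /= in n1 n2; rewrite (negPf n1) (negPf n2).
have -> : match_det (m + W) (prepend m (coords (bumped i0)) x) y =
   - match_det (m + W) (prepend m (coords (bumped i0)) x) y'.
  rewrite match_detC [in RHS]match_detC.
  have -> : match_det (m + W) y' (prepend m (coords (bumped i0)) x) =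
     (-1) ^+ s * match_det (m + W) y (prepend m (coords (bumped i0)) x).
    by apply: det_row_perm => i j; rewrite !mxE y's.
  have bb : Ordinal h1 != Ordinal h2 by rewrite -(inj_eq val_inj) /=; apply/eqP; lia.
  by rewrite odd_tperm bb expr1 mulN1r opprK.
rewrite match_det_block.
- rewrite match_detC; congr (- _); apply: eq_match_det => i iW.
    rewrite /y' /shift_at ifF; last by apply/eqP; lia.
    by rewrite eqn_add2l !yE maya_seq_tail //; case: eqP => [->|_]; lia.
  by rewrite /prepend ifF; [congr x; lia|lia].
- move=> i im; rewrite /prepend im.
  have im' : (m - i.+1 < m)%N by lia.
  rewrite (coords_bumped i0 (Ordinal im')) -(inj_eq val_inj) /= /y' !yE.
  have -> : (m - i.+1 == i0)%N = (i == b) by apply/eqP/eqP; lia.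
  case: eqP => [ib|_]; first by lia.
  by rewrite ifF; [lia|apply/eqP; lia].
move=> i j iW jW; have /= -> := y's (Ordinal iW); have /= -> := y's (Ordinal jW).
rewrite !yE => e; apply: (congr1 (@nat_of_ord _) (x := Ordinal iW) (y := Ordinal jW)).
by apply: (@perm_inj _ s); apply: val_inj => /=; lia.
Qed.

(** An entry below m in the class of i is i - q_i m with q_i a nonnegative
    integer, and the q_i add up to 1. *)
Lemma bumped_exhaust m (a : m.-tuple int) : (0 < m)%N ->
  phi_tuples m 1 a -> (forall i, tnth a i < m%:Z) -> exists i0, bumped i0 = a.
Proof.
move=> m0 [cl su] lt.
pose q (i : 'I_m) : int := ((i%:Z - tnth a i) %/ m%:Z)%Z.
have qE i : tnth a i = i%:Z - q i * m%:Z.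
  rewrite /q divzK ?subKr //.
  by rewrite -eqz_mod_dvd; apply/eqP/esym/cl.
have q0 i : 0 <= q i.
  have := lt i; rewrite qE; have := ltn_ord i; move: (q i) => t; nia.
have qs : \sum_i q i = 1.
  move: su; rewrite (eq_bigr _ (fun i _ => qE i)) sumrB -mulr_suml.
  move=> /addrI /oppr_inj; rewrite mul1r => e.
  by apply: (@mulIf _ m%:Z); rewrite ?mul1r //; lia.
have [i0 qi0] : exists i0, q i0 != 0.
  apply: contrapT => H; have : \sum_i q i = 0.
    by apply: big1 => i _; apply/eqP/negP => /negP qn; apply: H; exists i.
  by rewrite qs.
exists i0; apply: eq_from_tnth => i; rewrite tnth_mktuple qE.
have rest : 0 <= \sum_(j | j != i0) q j by apply: sumr_ge0.
move: qs; rewrite (bigD1 i0) //= => qs.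
have := q0 i0; case: (eqVneq i i0) => [->|ii0]; first move=> q0'.
  have -> : q i0 = 1; last by rewrite mul1r.
  move: qi0 q0' rest qs; move: (\sum_(j | _) _) (q i0) => t u; lia.
have : 0 <= \sum_(j | (j != i0) && (j != i)) q j by apply: sumr_ge0.
move: rest qs; rewrite (bigD1 i) //=; have := q0 i.
move: (\sum_(j | _) _) => t ? ? ? ? ?.
have -> : q i = 0 by lia.
by rewrite mul0r.
Qed.

Lemma bumped_tuples m (i0 : 'I_m) : phi_tuples m 1 (bumped i0).
Proof.
split=> [i|].
  apply/eqP; rewrite eqz_mod_dvd tnth_mktuple addrAC subrr add0r.
  by rewrite dvdzE abszN; case: (i == i0); rewrite //= ?dvdnn ?dvdn0.
rewrite mul1r (eq_bigr (fun i : 'I_m => i%:Z - m%:Z *+ (i == i0))).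
  rewrite sumrB; congr (_ - _); rewrite (bigD1 i0) //= eqxx big1 ?addr0 //.
  by move=> i /negPf ->.
by move=> i _; rewrite tnth_mktuple.
Qed.

Lemma size_part0 : size (parts part0) = 0%N.
Proof. by []. Qed.

Lemma phi_vacuum m (la : intpart) : (0 < m)%N ->
  (phi_maya int m 1 la)@_part0 = - (ribbon (- m%:Z) la)@_part0.
Proof.
move=> m0; pose W := (size la + m)%N.
rewrite ribbon_adj; last by lia.
rewrite opprK (@ribbon_coeff W) ?size_part0 //; try (rewrite /W; lia).
rewrite -(sum_widen (F := fun b => match_det W (shift_at (maya_seq part0) b m) (maya_seq la)) (n := m)); first last.
- by move=> b mb bW; apply: match_det_shift_tail0 => //; [lia|move=> j; exact: maya_seq_geW].
- by rewrite /W; lia.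
rewrite (reindex_inj rev_ord_inj) -sumrN.
rewrite (@phi_coeff_fs _ _ _ _ W) ?size_part0 //; try (rewrite /W; lia).
rewrite (fsbig_reindex (h := @bumped m) (Q := xpredT)).
- by apply: eq_bigr => i _; apply: bumped_coeff; rewrite /W; lia.
- move=> i j /(congr1 (fun t => tnth t i)); rewrite !tnth_mktuple eqxx.
  by case: eqP => // _; lia.
- by move=> i; split => // _; exact: bumped_tuples.
move=> a Pa /match_det_perm[s e]; apply: bumped_exhaust => // i.
have := e (lshift W (rev_ord i)); rewrite /= /prepend ifT; last by have := ltn_ord i; lia.
have -> : (m - (m - i.+1).+1)%N = i by have := ltn_ord i; lia.
by rewrite /coords -tnth_nth /translate maya_seq_tail // => ->; lia.
Qed.

(** * The operators A^+ and A^- on Lambda (x) Lambda *)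

Section LinExtTheory.
Variables (K K' : choiceType).

Lemma eq_lin_ext (V : lmodType int) (f g : K -> V) : f =1 g -> lin_ext f =1 lin_ext g.
Proof. by move=> e u; apply: eq_bigr => k _; rewrite e. Qed.

Lemma lin_ext_swap (V : lmodType int) (f : K -> K' -> V) u v :
  lin_ext (fun k => lin_ext (f k) v) u =
  lin_ext (fun h => lin_ext (fun k => f k h) u) v.
Proof.
rewrite /lin_ext; under eq_bigr do rewrite scaler_sumr.
rewrite exchange_big; apply: eq_bigr => h _; rewrite scaler_sumr.
by apply: eq_bigr => k _; rewrite !scalerA mulrC.
Qed.

End LinExtTheory.

Lemma lin_ext_lin (K : choiceType) (V W : lmodType int) (L : {linear V -> W})
    (g : K -> V) u : L (lin_ext g u) = lin_ext (fun k => L (g k)) u.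
Proof. by rewrite /lin_ext linear_sum; apply: eq_bigr => k _; rewrite linearZ. Qed.

(** [pairl k f] is f (x) s_k and [pairr a f] is s_a (x) f; [actX S] and [actY S]
    let S act on the first and second tensor factor.  They are sealed because all
    of them are convertible to a linear extension, so that unification would
    otherwise compare them by unfolding. *)
HB.lock Definition pairl (k : intpart) : Lambda -> Lambda2 :=
  lin_ext (fun a => << (a, k) >> : Lambda2).
HB.lock Definition pairr (a : intpart) : Lambda -> Lambda2 :=
  lin_ext (fun k => << (a, k) >> : Lambda2).
HB.lock Definition actX (S : intpart -> Lambda) : Lambda2 -> Lambda2 :=
  lin_ext (fun p : intpart * intpart => pairl p.2 (S p.1)).
HB.lock Definition actY (S : intpart -> Lambda) : Lambda2 -> Lambda2 :=
  lin_ext (fun p : intpart * intpart => pairr p.1 (S p.2)).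

Lemma pairl_is_linear k : linear (pairl k).
Proof. by rewrite unlock; exact: lin_ext_is_linear. Qed.
HB.instance Definition _ k := GRing.isLinear.Build int Lambda Lambda2 *:%R (pairl k)
  (pairl_is_linear k).

Lemma pairr_is_linear a : linear (pairr a).
Proof. by rewrite unlock; exact: lin_ext_is_linear. Qed.
HB.instance Definition _ a := GRing.isLinear.Build int Lambda Lambda2 *:%R (pairr a)
  (pairr_is_linear a).

Lemma actX_is_linear S : linear (actX S).
Proof. by rewrite unlock; exact: lin_ext_is_linear. Qed.
HB.instance Definition _ S := GRing.isLinear.Build int Lambda2 Lambda2 *:%R (actX S)
  (actX_is_linear S).

Lemma actY_is_linear S : linear (actY S).
Proof. by rewrite unlock; exact: lin_ext_is_linear. Qed.
HB.instance Definition _ S := GRing.isLinear.Build int Lambda2 Lambda2 *:%R (actY S)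
  (actY_is_linear S).

Lemma actX_U S p : actX S << p >> = pairl p.2 (S p.1).
Proof. by rewrite actX.unlock lin_extU. Qed.

Lemma actY_U S p : actY S << p >> = pairr p.1 (S p.2).
Proof. by rewrite actY.unlock lin_extU. Qed.

Lemma malgU_scale (K : choiceType) (c : int) (k : K) : << c *g k >> = c *: << k >>.
Proof. by apply/malgP => h; rewrite mcoeffZ !mcoeffU mulr_natr. Qed.

Lemma tens_pairl f k : tens f << k >> = pairl k f.
Proof.
rewrite pairl.unlock; apply: eq_bigr => a _.
by rewrite msuppU oner_eq0 big_seq_fset1 mcoeffUU mulr1 malgU_scale.
Qed.

Lemma tens_pairr a f : tens << a >> f = pairr a f.
Proof.
rewrite pairr.unlock /tens msuppU oner_eq0 big_seq_fset1; apply: eq_bigr => k _.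
by rewrite mcoeffUU mul1r malgU_scale.
Qed.

Lemma onXE (Op : Lambda -> Lambda) S : (forall a, Op << a >> = S a) -> onX Op =1 actX S.
Proof. by rewrite actX.unlock => e; apply: eq_lin_ext => p; rewrite tens_pairl e. Qed.

Lemma onYE (Op : Lambda -> Lambda) S : (forall a, Op << a >> = S a) -> onY Op =1 actY S.
Proof. by rewrite actY.unlock => e; apply: eq_lin_ext => p; rewrite tens_pairr e. Qed.

Lemma lin_extE (K : choiceType) (V : lmodType int) (L : {linear {malg int[K]} -> V}) u :
  L u = lin_ext (fun k => L << k >>) u.
Proof.
rewrite [in LHS](monalgE u) linear_sum; apply: eq_bigr => k _.
by rewrite malgU_scale linearZ.
Qed.

Lemma eq_linear (K : choiceType) (V : lmodType int) (L L' : {linear {malg int[K]} -> V}) :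
  (forall k, L << k >> = L' << k >>) -> L =1 L'.
Proof. by move=> e u; rewrite lin_extE [RHS]lin_extE; exact: eq_lin_ext. Qed.

Lemma pairlU k a : pairl k << a >> = << (a, k) >>.
Proof. by rewrite pairl.unlock lin_extU. Qed.

Lemma pairrU a k : pairr a << k >> = << (a, k) >>.
Proof. by rewrite pairr.unlock lin_extU. Qed.

Lemma actX_pairl S k f : actX S (pairl k f) = pairl k (lin_ext S f).
Proof.
apply: (eq_linear (L := actX S \o pairl k) (L' := pairl k \o lin_ext S)) => a /=.
by rewrite pairlU actX_U lin_extU.
Qed.

Lemma actY_pairr S a f : actY S (pairr a f) = pairr a (lin_ext S f).
Proof.
apply: (eq_linear (L := actY S \o pairr a) (L' := pairr a \o lin_ext S)) => k /=.
by rewrite pairrU actY_U lin_extU.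
Qed.

Lemma actX_comm S S' : (forall a, lin_ext S (S' a) = lin_ext S' (S a)) ->
  forall t, actX S (actX S' t) = actX S' (actX S t).
Proof.
move=> e; apply: (eq_linear (L := actX S \o actX S') (L' := actX S' \o actX S)) => p /=.
by rewrite !actX_U !actX_pairl e.
Qed.

Lemma actY_comm S S' : (forall a, lin_ext S (S' a) = lin_ext S' (S a)) ->
  forall t, actY S (actY S' t) = actY S' (actY S t).
Proof.
move=> e; apply: (eq_linear (L := actY S \o actY S') (L' := actY S' \o actY S)) => p /=.
by rewrite !actY_U !actY_pairr e.
Qed.

Lemma actXY_comm S S' t : actX S (actY S' t) = actY S' (actX S t).
Proof.
apply: (eq_linear (L := actX S \o actY S') (L' := actY S' \o actX S)) => -[a k] /=.
have e1 f : actX S (pairr a f) = lin_ext (fun h => pairl h (S a)) f.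
  apply: (eq_linear (L := actX S \o pairr a) (L' := lin_ext (fun h => pairl h (S a)))) => h /=.
  by rewrite pairrU actX_U lin_extU.
have e2 f : actY S' (pairl k f) = lin_ext (fun b => pairr b (S' k)) f.
  apply: (eq_linear (L := actY S' \o pairl k) (L' := lin_ext (fun b => pairr b (S' k)))) => b /=.
  by rewrite pairlU actY_U lin_extU.
rewrite actY_U actX_U /= e1 e2 pairl.unlock pairr.unlock.
exact: (lin_ext_swap (fun h b : intpart => << (b, h) >> : Lambda2)).
Qed.

(** This is A^-_k for k > 0 and A^+_(-k) for k < 0. *)
Definition Aop (k : int) (t : Lambda2) : Lambda2 := actX (ribbon k) t + actY (ribbon (- k)) t.

Lemma Aop_is_linear k : linear (Aop k).
Proof. by move=> c u v; rewrite /Aop !linearP scalerDr addrACA. Qed.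

HB.instance Definition _ k := GRing.isLinear.Build int Lambda2 Lambda2 *:%R (Aop k)
  (@Aop_is_linear k).

Lemma psum_mulU i a : (0 < i)%N -> psum_mul i << a >> = ribbon i%:Z a.
Proof. by move=> i0; apply: etrans (psum_mulE _ i0) (lin_extU _ _). Qed.

Lemma psum_perpU i a : (0 < i)%N -> psum_perp i << a >> = ribbon (- i%:Z) a.
Proof. by move=> i0; apply: etrans (psum_perpE _ i0) (lin_extU _ _). Qed.

Lemma AplusE i : (0 < i)%N -> Aplus i =1 Aop (- i%:Z).
Proof.
move=> i0 t.
have eX := onXE (fun a => psum_perpU a i0) t.
have eY := onYE (fun a => psum_mulU a i0) t.
by rewrite /Aplus eX eY /Aop (opprK i%:Z).
Qed.

Lemma AminusE i : (0 < i)%N -> Aminus i =1 Aop i%:Z.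
Proof.
move=> i0 t.
have eX := onXE (fun a => psum_mulU a i0) t.
have eY := onYE (fun a => psum_perpU a i0) t.
by rewrite /Aminus eX eY.
Qed.

Lemma Aop_comm (j k : int) t : j != 0 -> k != 0 -> j + k != 0 ->
  Aop j (Aop k t) = Aop k (Aop j t).
Proof.
move=> j0 k0 jk; rewrite /Aop !(linearD (actX _)) !(linearD (actY _)) /=.
rewrite (actXY_comm (ribbon j)) (actXY_comm (ribbon k)) (actX_comm (fun a => ribbon_comm a j0 k0 jk)).
have jk' : - j - k != 0 by rewrite -opprD oppr_eq0.
have nj : - j != 0 by rewrite oppr_eq0.
have nk : - k != 0 by rewrite oppr_eq0.
rewrite (actY_comm (fun a => ribbon_comm a nj nk jk')).
by rewrite -!addrA; congr (_ + _); rewrite !addrA; congr (_ + _); rewrite addrC.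
Qed.

Lemma foldr_comm (f : Lambda2 -> Lambda2) l t :
  (forall j t, j \in l -> f (Aop j t) = Aop j (f t)) ->
  f (foldr Aop t l) = foldr Aop (f t) l.
Proof.
elim: l => //= j l IH H; rewrite H ?mem_head // IH // => i u il.
by apply: H; rewrite in_cons il orbT.
Qed.

(** * Removing a part m *)

Definition vac (t : Lambda2) : int := t@_(part0, part0).

Lemma vac_lin_ext (f : intpart * intpart -> Lambda2) t :
  vac (lin_ext f t) = \sum_(p <- msupp t) t@_p * vac (f p).
Proof.
by rewrite /vac /lin_ext raddf_sum; apply: eq_bigr => p _; rewrite /= mcoeffZ.
Qed.

Lemma vac_pairl k f : vac (pairl k f) = f@_part0 *+ (k == part0).
Proof.
rewrite /vac pairl.unlock /lin_ext raddf_sum -hallU hallE mmapE -sumrMnl.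
apply: eq_bigr => a _ /=; rewrite mcoeffZ !mcoeffU intz xpair_eqE.
by rewrite [part0 == a]eq_sym; case: (a == _); case: (k == _); rewrite ?mulr0 ?mulr0n.
Qed.

Lemma vac_pairr a f : vac (pairr a f) = f@_part0 *+ (a == part0).
Proof.
rewrite /vac pairr.unlock /lin_ext raddf_sum -hallU hallE mmapE -sumrMnl.
apply: eq_bigr => k _ /=; rewrite mcoeffZ !mcoeffU intz xpair_eqE.
by rewrite [part0 == k]eq_sym; case: (a == _); case: (k == _); rewrite ?mulr0 ?mulr0n.
Qed.

Lemma ribbon_vacuum m la : (0 < m)%N -> (ribbon m%:Z la)@_part0 = 0.
Proof.
move=> m0; apply/eqP/negP => /negP; have k0 : m%:Z != 0 by lia.
by move/(ribbon_degree k0); have -> : psize part0 = 0%N by []; lia.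
Qed.

Lemma vac_actX S t : vac (actX S t) = \sum_(p <- msupp t) t@_p * vac (pairl p.2 (S p.1)).
Proof. by rewrite actX.unlock vac_lin_ext. Qed.

Lemma vac_actY S t : vac (actY S t) = \sum_(p <- msupp t) t@_p * vac (pairr p.1 (S p.2)).
Proof. by rewrite actY.unlock vac_lin_ext. Qed.

Lemma vacD u v : vac (u + v) = vac u + vac v.
Proof. exact: mcoeffD. Qed.

(** The summand p_m(Y) has no constant term, and p_m^perp(X) is exchanged for
    phi by [phi_vacuum]. *)
Lemma vac_Aop_neg m t : (0 < m)%N ->
  vac (Aop (- m%:Z) t) = - vac (actX (phi_maya int m 1) t).
Proof.
move=> m0; rewrite /Aop vacD (opprK m%:Z) !vac_actX vac_actY.
rewrite [X in _ + X]big1 ?addr0 => [|p _]; last first.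
  by rewrite vac_pairr ribbon_vacuum // mul0rn mulr0.
rewrite -sumrN; apply: eq_bigr => p _.
by rewrite !vac_pairl phi_vacuum // mulNrn mulrN opprK.
Qed.

Lemma vac_Aop_pos m t : (0 < m)%N ->
  vac (Aop m%:Z t) = - vac (actY (phi_maya int m 1) t).
Proof.
move=> m0; rewrite /Aop vacD !vac_actY vac_actX.
rewrite [X in X + _]big1 ?add0r => [|p _]; last first.
  by rewrite vac_pairl ribbon_vacuum // mul0rn mulr0.
rewrite -sumrN; apply: eq_bigr => p _.
by rewrite !vac_pairr phi_vacuum // mulNrn mulrN opprK.
Qed.

Lemma actX_phi_comm m j t : (0 < m)%N -> ~~ (m %| absz j)%N ->
  actX (phi_maya int m 1) (Aop j t) = Aop j (actX (phi_maya int m 1) t).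
Proof.
move=> m0 mj; rewrite /Aop (linearD (actX _)) /= actXY_comm; congr (_ + _).
by apply: actX_comm => a; exact: phi_ribbon_comm.
Qed.

Lemma actY_phi_comm m j t : (0 < m)%N -> ~~ (m %| absz j)%N ->
  actY (phi_maya int m 1) (Aop j t) = Aop j (actY (phi_maya int m 1) t).
Proof.
move=> m0 mj; rewrite /Aop (linearD (actY _)) /= -actXY_comm; congr (_ + _).
by apply: actY_comm => a; apply: phi_ribbon_comm; rewrite ?abszN.
Qed.

(** The indices of the operators [Aop] in the order in which they occur in the
    Frobenius-type formula. *)
Definition word (mu nu : seq nat) : seq int :=
  [seq - i%:Z | i <- mu] ++ [seq i%:Z | i <- nu].

Lemma part_pos (mu : intpart) i : i \in parts mu -> (0 < i)%N.
Proof.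
by rewrite lt0n => im; apply: contraNneq (proj2 (andP (valP mu))) => <-.
Qed.

Lemma frobeniusE la ka (mu nu : intpart) :
  frobenius_coeff la ka mu nu = vac (foldr Aop << (la, ka) >> (word mu nu)).
Proof.
rewrite /frobenius_coeff /word foldr_cat -/(vac _); congr vac.
have E (f : nat -> Lambda2 -> Lambda2) (g : nat -> int) (l : seq nat) t :
    (forall i, i \in l -> f i =1 Aop (g i)) -> foldr f t l = foldr Aop t (map g l).
  elim: l => //= i l IH H; rewrite H ?mem_head // IH // => j jl.
  by apply: H; rewrite in_cons jl orbT.
rewrite (E _ (fun i => - i%:Z)) => [|i /part_pos]; last exact: AplusE.
by congr foldr; apply: E => i /part_pos; exact: AminusE.
Qed.

Lemma part_add_split m (mu : intpart) : (0 < m)%N ->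
  exists s1 s2, parts (part_add m mu) = s1 ++ m :: s2 /\ parts mu = s1 ++ s2.
Proof.
move=> m0.
have pe : perm_eq (parts (part_add m mu)) (m :: parts mu).
  rewrite /= perm_sort; apply/permPl; rewrite -lt0n m0 /=.
  rewrite (all_filterP _) //; apply/allP => i /part_pos; by rewrite lt0n.
have : m \in parts (part_add m mu) by rewrite (perm_mem pe) mem_head.
have : is_part (parts (part_add m mu)) by exact: valP.
move: pe; move: (parts (part_add m mu)) => s pe so m_s; case/splitPr: m_s pe so => s1 s2 pe so.
exists s1, s2; split => //.
have pe' : perm_eq (s1 ++ s2) (parts mu).
  by rewrite -(perm_cons m) -(permPr pe) perm_sym; apply/permPl; exact: (perm_catCA s1 [:: m]).
apply/esym/(sorted_eq (rev_trans leq_trans)) => //.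
- by move=> i j; rewrite andbC; exact: anti_leq.
- apply: (subseq_sorted (rev_trans leq_trans) _ (proj1 (andP so))).
  exact: cat_subseq (subseq_refl _) (subseq_cons _ _).
exact: (proj1 (andP (valP mu))).
Qed.

Lemma mem_word x (mu nu : intpart) : x \in word mu nu ->
  (exists2 i, i \in parts mu & x = - i%:Z) \/ (exists2 i, i \in parts nu & x = i%:Z).
Proof.
by rewrite mem_cat => /orP[] /mapP; case=> i im ->; [left|right]; exists i.
Qed.

Lemma word_ndiv m x (mu nu : intpart) : no_part_divisible m mu ->
  no_part_divisible m nu -> x \in word mu nu -> ~~ (m %| absz x)%N.
Proof.
by move=> dm dn /mem_word[] [i im ->]; rewrite ?abszN ?absz_nat; [exact: dm|exact: dn].
Qed.

Lemma vac_foldr (K : choiceType) l (f : K -> Lambda2) u :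
  vac (foldr Aop (lin_ext f u) l) = lsum (fun k => vac (foldr Aop (f k) l)) u.
Proof.
have E : foldr Aop (lin_ext f u) l = lin_ext (fun k => foldr Aop (f k) l) u.
  by elim: l => //= j l ->; exact: (lin_ext_lin (Aop j)).
rewrite E /vac /lin_ext raddf_sum mmapE; apply: eq_bigr => k _ /=.
by rewrite mcoeffZ intz.
Qed.

Lemma frobenius_plus m la ka (mu nu : intpart) : (0 < m)%N ->
  no_part_divisible m mu -> no_part_divisible m nu ->
  frobenius_coeff la ka (part_add m mu) nu =
  - lsum (fun la' => frobenius_coeff la' ka mu nu) (phi_maya int m 1 la).
Proof.
move=> m0 dm dn.
have [s1 [s2 [e1 e2]]] := part_add_split mu m0.
transitivity (vac (Aop (- m%:Z) (foldr Aop << (la, ka) >> (word mu nu)))).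
  rewrite frobeniusE; congr vac; rewrite /word e1 e2 !map_cat -!catA foldr_cat.
  rewrite [in RHS]foldr_cat /= -foldr_comm // => j t /mapP; case=> i im ->.
  have i0 : (0 < i)%N by apply: (@part_pos mu); rewrite e2 mem_cat im.
  by apply: Aop_comm; lia.
rewrite vac_Aop_neg // foldr_comm => [|j t jw]; last first.
  by apply: actX_phi_comm => //; exact: word_ndiv jw.
rewrite actX_U pairl.unlock vac_foldr; congr (- _); apply: eq_lsum => k _.
by rewrite frobeniusE.
Qed.

(** The new factor A^-_m now has to pass the factors A^+_i as well; it commutes
    with them since i <> m, m not dividing any part of [mu]. *)
Lemma frobenius_minus m la ka (mu nu : intpart) : (0 < m)%N ->
  no_part_divisible m mu -> no_part_divisible m nu ->
  frobenius_coeff la ka mu (part_add m nu) =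
  - lsum (fun ka' => frobenius_coeff la ka' mu nu) (phi_maya int m 1 ka).
Proof.
move=> m0 dm dn.
have [s1 [s2 [e1 e2]]] := part_add_split nu m0.
transitivity (vac (Aop m%:Z (foldr Aop << (la, ka) >> (word mu nu)))).
  rewrite frobeniusE; congr vac; rewrite /word e1 e2 !map_cat catA foldr_cat.
  rewrite [in RHS]catA [in RHS]foldr_cat /= -foldr_comm // => j t.
  rewrite mem_cat => /orP[] /mapP; case=> i im ->.
    have := dm i im; have := part_pos im => i0 di.
    by apply: Aop_comm; try lia; apply: contraNneq di => e; have -> : i = m by lia.
  have i0 : (0 < i)%N by apply: (@part_pos nu); rewrite e2 mem_cat im.
  by apply: Aop_comm; lia.
rewrite vac_Aop_pos // foldr_comm => [|j t jw]; last first.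
  by apply: actY_phi_comm => //; exact: word_ndiv jw.
rewrite actY_U pairr.unlock vac_foldr; congr (- _); apply: eq_lsum => k _.
by rewrite frobeniusE.
Qed.

(** * From coefficients to characters *)

Lemma Cx_const_int (R : realType) (n : int) : Cx_const (n%:~R : R[i]) = n%:~R.
Proof. by rewrite /Cx_const !rmorph_int. Qed.

Lemma msupp_phi (G : numDomainType) m k la :
  msupp (phi_maya G m k la) = msupp (phi_maya int m k la).
Proof.
apply/fsetP => mu; rewrite -!mcoeff_neq0 phi_maya_intr.
by rewrite intr_eq0.
Qed.

Lemma phi_degree m k (la mu : intpart) : (phi_maya int m k la)@_mu != 0 ->
  (psize mu)%:Z + k * m%:Z = (psize la)%:Z.
Proof.
rewrite (@phi_coeff _ _ _ _ (size la + size mu)); try lia.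
by case: ifP => [/eqP //|_]; rewrite eqxx.
Qed.

Lemma msupp_U (G : nzRingType) (ka : intpart) : msupp (<< ka >> : {malg G[intpart]}) = [fset ka]%fset.
Proof. by rewrite msuppU oner_eq0. Qed.

(** Evaluation of the linear extension at -phi: the coefficients of phi are
    integers, and only partitions in its support need a character value. *)
Lemma chi_ext_phi (R : realType) m (la : intpart) (X : intpart -> Cx R) (Y : intpart -> int) :
  (forall la', (phi_maya int m 1 la)@_la' != 0 -> X la' = (Y la')%:~R) ->
  \sum_(la' <- msupp (- phi m 1 << la >> : {malg R[i][intpart]}))
     Cx_const (- phi m 1 << la >> : {malg R[i][intpart]})@_la' * X la' =
  (- lsum Y (phi_maya int m 1 la))%:~R.
Proof.
move=> XY; rewrite msuppN.
have -> : phi m 1 << la >> = phi_maya R[i] m 1 la by exact: lin_extU.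
rewrite msupp_phi mmapE -[in RHS]sumrN [RHS]rmorph_sum; apply: eq_big_seq => la'.
rewrite -mcoeff_neq0 => nz; rewrite XY // mcoeffN phi_maya_intr -rmorphN Cx_const_int.
by rewrite /= intz -rmorphM mulNr.
Qed.

Theorem theorem5p4 (R : realType) (chi : char_family R)
    (chi_irr : irr_labelling chi)
    (m r s : nat) (m_ge1 : (1 <= m)%N) (la ka : intpart)
    (la_ka : is_label r s la ka) (mu nu : intpart)
    (mu_m : no_part_divisible m mu) (nu_m : no_part_divisible m nu) :
  ((m <= r)%N -> psize mu = (r - m)%N -> psize nu = s ->
     forall (u : 'S_r) (u' : 'S_(r - m)) (v v' : 'S_s),
       cycle_type u = part_add m mu -> cycle_type u' = mu ->
       cycle_type v = nu -> cycle_type v' = nu ->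
       chi r s la ka << wperm u v >> =
       chi_ext chi (- phi m 1 << la >>) << ka >> << wperm u' v' >>)
  /\
  ((m <= s)%N -> psize mu = r -> psize nu = (s - m)%N ->
     forall (u u' : 'S_r) (v : 'S_s) (v' : 'S_(s - m)),
       cycle_type u = mu -> cycle_type u' = mu ->
       cycle_type v = part_add m nu -> cycle_type v' = nu ->
       chi r s la ka << wperm u v >> =
       chi_ext chi << la >> (- phi m 1 << ka >>) << wperm u' v' >>).
Proof.
split=> [m_le_r smu snu u u' v v' cu cu' cv cv'|m_le_s smu snu u u' v v' cu cu' cv cv'].
  rewrite (labelling_frobenius chi_irr) // cu cv (frobenius_plus la ka m_ge1 mu_m nu_m).
  rewrite -(@chi_ext_phi R m la (fun la' => chi (r - m)%N s la' ka << wperm u' v' >>)).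
    apply: eq_bigr => la' _; rewrite msupp_U big_seq_fset1 mcoeffUU.
    by rewrite (Cx_const_int R 1) mulr1.
  move=> la' /phi_degree deg; rewrite (labelling_frobenius chi_irr) ?cu' ?cv' //.
  have [i [ile e1 e2]] := la_ka.
  by exists i; split; lia.
rewrite (labelling_frobenius chi_irr) // cu cv (frobenius_minus la ka m_ge1 mu_m nu_m).
rewrite -(@chi_ext_phi R m ka (fun ka' => chi r (s - m)%N la ka' << wperm u' v' >>)).
  rewrite /chi_ext msupp_U big_seq_fset1; apply: eq_bigr => ka' _.
  by rewrite mcoeffUU (Cx_const_int R 1) mul1r.
move=> ka' /phi_degree deg; rewrite (labelling_frobenius chi_irr) ?cu' ?cv' //.
have [i [ile e1 e2]] := la_ka.
by exists i; split; lia.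
Qed.
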